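(* For every fixed integer $a\ge0$, the maximum of the limiting density $D(U)$ over all nonempty retention rules $U\subseteq\{\mathrm E,\mathrm L,\mathrm H\}^{a+2}$ on the window $[-a,1]$ is equal to $7/2$.
   Context: A (rooted ordered binary) tree is either the one-leaf tree $E$ or an ordered pair $(T_0,T_1)$ of trees. The height is $\mathrm{ht}(E)=0$, $\mathrm{ht}((T_0,T_1))=1+\max(\mathrm{ht}(T_0),\mathrm{ht}(T_1))$. A marked forest $v(\mathcal F,i)$ is a finite nonempty sequence $\mathcal F=(T_1,\dots,T_m)$ of trees together with a marked position $i\in\{1,\dots,m\}$. $\mathrm{BB}(n,k)$ is the set of marked forests with $n$ leaves in total and all tree heights at most $k$. It is regarded as an undirected graph with the following edges: (horizontal) $v(\mathcal F,i)$ is adjacent to $v(\mathcal F,i+1)$; (vertical) if $T_i=(A,B)$, then $v(\mathcal F,i)$ is adjacent to $v(\mathcal F',i)$, where $\mathcal F'$ is obtained from $\mathcal F$ by replacing the entry $T_i$ by the two consecutive entries $A,B$ (a split, with the marker at the left child $A$; the inverse operation is a merge, allowed when the merged tree has height at most $k$). (This graph is isomorphic to a finite induced subgraph of the Cayley graph of Thompson's group $F$ with its standard two generators.) For a nonempty set $Y$ of vertices, $\operatorname{dens}(Y)=2|E(Y)|/|Y|$, where $E(Y)$ is the set of edges with both endpoints in $Y$. For $k\ge3$, the category of a tree $T$ of height at most $k$ is $\mathrm E$ if $T=E$, $\mathrm H$ if $\mathrm{ht}(T)=k$, and $\mathrm L$ if $1\le\mathrm{ht}(T)\le k-1$. For $a,b\ge0$,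 the type (for the window $[-a,b]$) of a marked forest $v(\mathcal F,i)$ is the word of $a+b+1$ categories of the trees $T_{i-a},\dots,T_{i+b}$. (Markers too close to a forest end may be treated by any convention; this has no effect on the limits.) A retention rule is a nonempty set $U\subseteq\{\mathrm E,\mathrm L,\mathrm H\}^{a+b+1}$: one retains precisely the vertices of $\mathrm{BB}(n,k)$ whose type is in $U$. Its limiting density is $D(U)=\lim_{k\to\infty}\lim_{n\to\infty}\operatorname{dens}(Y_{n,k}(U))$, where $Y_{n,k}(U)\subseteq\mathrm{BB}(n,k)$ is the set of retained vertices. *)

(* Defs.v *)
From HB Require Import structures.
From mathcomp Require Import all_boot all_order all_algebra finmap.
From mathcomp Require Import all_classical all_reals all_analysis.

Set Implicit Arguments.
Unset Strict Implicit.
Unset Printing Implicit Defensive.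

Import Order.TTheory GRing.Theory Num.Theory.
Import numFieldNormedType.Exports.

Local Open Scope classical_set_scope.
Local Open Scope ring_scope.

Inductive tree : Type := Leaf | Node of tree & tree.

Fixpoint tree_encode (t : tree) : GenTree.tree unit :=
  match t with
  | Leaf => GenTree.Leaf tt
  | Node A B => GenTree.Node 0 [:: tree_encode A; tree_encode B]
  end.

Fixpoint tree_decode (t : GenTree.tree unit) : option tree :=
  match t with
  | GenTree.Leaf _ => Some Leaf
  | GenTree.Node _ [:: A; B] =>
      match tree_decode A, tree_decode B with
      | Some A', Some B' => Some (Node A' B')
      | _, _ => None
      end
  | _ => None
  end.

Lemma tree_encodeK : pcancel tree_encode tree_decode.
Proof. by elim=> [|A IHA B IHB] //=; rewrite IHA IHB. Qed.

HB.instance Definition _ := Countable.copy tree (pcan_type tree_encodeK).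

Fixpoint height (t : tree) : nat :=
  if t is Node A B then (maxn (height A) (height B)).+1 else 0%N.

Fixpoint leaves (t : tree) : nat :=
  if t is Node A B then (leaves A + leaves B)%N else 1%N.

(* A forest with a marked position, counted from 0.  The constraint that the
   position lies in the forest (hence that the forest is nonempty) is imposed
   in [BB]. *)
Definition mforest : Type := (seq tree * nat)%type.

Definition BB (n k : nat) : set mforest :=
  [set v | [/\ (v.2 < size v.1)%N,
               (\sum_(t <- v.1) leaves t)%N = n &
               all (fun t => height t <= k)%N v.1]].

Definition horizontal (u v : mforest) : Prop :=
  v.1 = u.1 /\ v.2 = u.2.+1.

Definition vertical (u v : mforest) : Prop :=
  exists s A B r,
    u = (s ++ Node A B :: r, size s) /\ v = (s ++ [:: A, B & r], size s).

Definition adjacent (u v : mforest) : Prop :=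
  [\/ horizontal u v, horizontal v u, vertical u v | vertical v u].

(* The graph is simple and loop-free, so an edge is a two-element set. *)
Definition edges (Y : set mforest) : set {fset mforest} :=
  [set e | exists u v, [/\ Y u, Y v, adjacent u v & e = [fset u; v]%fset]].

(* [fset_set] is meaningful on finite sets only; see [finite_BB] and
   [finite_edges] below. *)
Definition dens (R : realType) (Y : set mforest) : R :=
  2 * #|` fset_set (edges Y)|%:R / #|` fset_set Y|%:R.

Inductive category : Type := CE | CL | CH.

Definition cat_of (k : nat) (t : tree) : category :=
  if t is Leaf then CE else if height t == k then CH else CL.

Definition word (a b : nat) : Type := (a + b).+1.-tuple category.

(* How to treat a marked forest whose window [-a, b] overruns an end of the
   forest, for each height bound: assign it some word as its type, or [None]
   (it is then never retained). *)
Definition boundary_convention (a b : nat) : Type :=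
  nat -> mforest -> option (word a b).

Definition vtype (a b : nat) (c : boundary_convention a b) (k : nat)
    (v : mforest) : option (word a b) :=
  if ((a <= v.2) && (v.2 + b < size v.1))%N
  then Some [tuple cat_of k (nth Leaf v.1 (v.2 + j - a)) | j < (a + b).+1]
  else c k v.

Definition retained (a b : nat) (c : boundary_convention a b)
    (U : set (word a b)) (n k : nat) : set mforest :=
  [set v | BB n k v /\ exists2 w, vtype c k v = Some w & U w].

Definition inner_density (R : realType) (a b : nat)
    (c : boundary_convention a b) (U : set (word a b)) (k : nat) : R :=
  lim (dens R (retained c U n k) @[n --> \oo]).

Definition limiting_density (R : realType) (a b : nat) (c : boundary_convention a b)
    (U : set (word a b)) : R :=
  lim (inner_density R c U k @[k --> \oo]).

(* [lim] is a total operator: this asserts that both limits in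
   [limiting_density] exist. *)
Definition limiting_density_exists (R : realType) (a b : nat) (c : boundary_convention a b)
    (U : set (word a b)) : Prop :=
  (forall k, (3 <= k)%N -> cvg (dens R (retained c U n k) @[n --> \oo])) /\
  cvg (inner_density R c U k @[k --> \oo]).

Lemma finite_trees (k : nat) : finite_set [set t | (height t <= k)%N].
Proof.
elim: k => [|k IHk].
  by apply: (@sub_finite_set _ _ [set Leaf]) => // -[].
apply: (@sub_finite_set _ _
  (Leaf |` [set Node p.1 p.2 | p in [set t | (height t <= k)%N] `*`
                                    [set t | (height t <= k)%N]])).
  move=> [|A B] /=; first by left.
  by rewrite ltnS geq_max => /andP[hA hB]; right; exists (A, B).
rewrite finite_setU; split; first exact: finite_set1.
exact/finite_image/finite_setX.
Qed.

Lemma leaves_gt0 (t : tree) : (0 < leaves t)%N.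
Proof. by elim: t => //= A hA B _; rewrite addn_gt0 hA. Qed.

Lemma finite_forests (n k : nat) :
  finite_set [set s | (size s <= n)%N && all (fun t => height t <= k)%N s].
Proof.
elim: n => [|n IHn].
  by apply: (@sub_finite_set _ _ [set [::]]) => // -[].
apply: (@sub_finite_set _ _
  ([::] |` [set p.1 :: p.2 | p in [set t | (height t <= k)%N] `*`
     [set s | (size s <= n)%N && all (fun t => height t <= k)%N s]])).
  move=> [|t s] /=; first by left.
  by rewrite ltnS => /and3P[sn ht hs]; right; exists (t, s) => //=; rewrite sn hs.
rewrite finite_setU; split; first exact: finite_set1.
exact/finite_image/finite_setX/IHn/finite_trees.
Qed.

Lemma finite_BB (n k : nat) : finite_set (BB n k).
Proof.
apply: (@sub_finite_set _ _
  ([set s | (size s <= n)%N && all (fun t => height t <= k)%N s] `*` `I_n)).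
  move=> [s i] [/= lt_is <- hs].
  have le_s : (size s <= \sum_(t <- s) leaves t)%N.
    by rewrite -sum1_size leq_sum// => t _; exact: leaves_gt0.
  by rewrite le_s hs; split=> //; exact: leq_trans lt_is le_s.
by apply: finite_setX; [exact: finite_forests|exact: finite_II].
Qed.

Lemma finite_edges (Y : set mforest) : finite_set Y -> finite_set (edges Y).
Proof.
move=> finY; apply: (@sub_finite_set _ _
  [set [fset p.1; p.2]%fset | p in Y `*` Y]).
  by move=> _ [u [v [Yu Yv _ ->]]]; exists (u, v).
exact/finite_image/finite_setX.
Qed.

(* Main.v *)
Require Import Defs.
From HB Require Import structures.
From mathcomp Require Import all_boot all_order all_algebra finmap.
From mathcomp Require Import all_classical all_reals all_analysis.
From mathcomp Require Import ring lra zify.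

Set Implicit Arguments.
Unset Strict Implicit.
Unset Printing Implicit Defensive.

Import Order.TTheory GRing.Theory Num.Theory.
Import numFieldNormedType.Exports.

Local Open Scope classical_set_scope.
Local Open Scope ring_scope.

(** Give every leaf the weight [x] for which the trees of height at most [k] have
    total weight one.  Then a uniform marked forest with [n] leaves looks, around
    its mark and for large [n], like an independent sequence of trees, each tree
    [t] having probability [x ^+ leaves t].  This is a renewal theorem
    ([renewal_oscillation], [self_convolution_ratio]) together with the bijection
    that cuts a forest around its window ([count_by_window]): the number of
    marked forests with a given window is the number of pairs of forests on the
    remaining leaves, and the marks without a complete window are negligible.
    Every edge has an origin and one of two directions ([card_edges]), and
    whether a mark is the origin of a horizontal or of a vertical edge is again
    read off a window.  So the density tends to [2 * (H + V) / P], where [P],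
    [H] and [V] are the probabilities that the marked tree is retained, that it
    and its right neighbour both are, and that it and its split both are
    ([dens_limit]).

    These probabilities depend on the trees through their categories only.  With
    [q] and [m] the masses of the trees of height less than [k] and [k - 1], the
    recursion of the generating function gives [q ^+ 2 = 1 - x] and
    [m ^+ 2 = q - x], while [x] tends to [1 / 4] ([critical_weight_cvg]); hence
    the category masses converge, and with them the density.

    For the full rule [P = H = 1] and [V = 3 / 4], as three marked trees out of
    four are not leaves; the density is [7 / 2].

    For the upper bound let [s = 3 / 4].  Two consecutive windows share all but
    one letter each; given the shared word [w] they are independent, so that [H]
    is the mean of [out w * r w], with [out w] and [r w] the conditional
    probabilities that the left and the right window are retained.  Since
    [0 <= out w <= 1], this is at most [s * out w] plus the positive part of
    [r w - s], and so [H <= s * P + S] with [S] the mean of that positive part.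
    It remains to see that [V + S <= P].  This is a statement about one fixed
    context to the left of the marked tree: writing [r c] for the probability
    that this context followed by [c] and a random letter is retained, and [p c]
    for the mass of [c], it says that the vertical edges in this context weigh at
    most the sum of the [p c * min (r c) s] ([vertical_truncation]). *)

(** * Enumerating trees and forests *)

Fixpoint words (T : Type) (A : seq T) (m : nat) : seq (seq T) :=
  if m is m'.+1 then [seq t :: w | t <- A, w <- words A m'] else [:: [::]].

Lemma mem_words (T : eqType) (A : seq T) m w :
  (w \in words A m) = (size w == m) && all (mem A) w.
Proof.
elim: m w => [|m IH] [|t w] //=; first by apply/allpairsP => -[[x y] /= []].
apply/allpairsP/idP => [[[x y] /= [xA]]|/and3P[sw tA wA]].
  by rewrite IH => /andP[/eqP <- yA] [-> ->]; rewrite eqxx xA.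
by exists (t, w); rewrite /= tA IH -eqSS sw.
Qed.

Lemma words_uniq (T : eqType) (A : seq T) m : uniq A -> uniq (words A m).
Proof.
move=> uA; elim: m => //= m IH.
by apply: allpairs_uniq => // -[x y] [x' y'] _ _ [-> ->].
Qed.

Fixpoint trees (k : nat) : seq tree :=
  if k is k'.+1 then Leaf :: [seq Node A B | A <- trees k', B <- trees k']
  else [:: Leaf].

Lemma mem_trees k t : (t \in trees k) = (height t <= k)%N.
Proof.
elim: k t => [|k IH] [|A B] //=; rewrite in_cons /= ltnS geq_max -!IH.
apply/allpairsP/andP => [[[x y] /= [? ? [-> ->]]]|[hA hB]] //.
by exists (A, B).
Qed.

Lemma trees_uniq k : uniq (trees k).
Proof.
elim: k => //= k IH; apply/andP; split; first by apply/allpairsP => -[[x y] []].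
by apply: allpairs_uniq => // -[x y] [x' y'] _ _ [-> ->].
Qed.

Definition forest_leaves (s : seq tree) : nat := \sum_(t <- s) leaves t.

Lemma forest_leaves_cons t s : forest_leaves (t :: s) = (leaves t + forest_leaves s)%N.
Proof. by rewrite /forest_leaves big_cons. Qed.

Lemma forest_leaves_cat s r :
  forest_leaves (s ++ r) = (forest_leaves s + forest_leaves r)%N.
Proof. by rewrite /forest_leaves big_cat. Qed.

Lemma size_forest_leaves s : (size s <= forest_leaves s)%N.
Proof. by rewrite -sum1_size leq_sum// => t _; exact: leaves_gt0. Qed.

(** Every tree has a leaf, so a forest with [n] leaves has at most [n] trees. *)
Definition forests (k n : nat) : seq (seq tree) :=
  undup [seq s <- flatten [seq words (trees k) m | m <- iota 0 n.+1]
           | forest_leaves s == n].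

Lemma forests_uniq k n : uniq (forests k n).
Proof. exact: undup_uniq. Qed.

Lemma mem_forests k n s :
  (s \in forests k n) = (forest_leaves s == n) && all (fun t => height t <= k)%N s.
Proof.
rewrite mem_undup mem_filter; have [sn|//] := eqVneq.
rewrite andTb andTb; apply/flattenP/idP.
  move=> [_ /mapP[m _ ->]]; rewrite mem_words => /andP[_]; apply: sub_all => t.
  by rewrite /= mem_trees.
move=> hs; exists (words (trees k) (size s)).
  by rewrite map_f// mem_iota add0n ltnS -sn size_forest_leaves.
by rewrite mem_words eqxx /=; apply: sub_all hs => t; rewrite /= mem_trees.
Qed.

Lemma size_forests0 k : size (forests k 0) = 1%N.
Proof.
rewrite -[1%N]/(size [:: [::] : seq tree]); apply/perm_size/uniq_perm => //.
  exact: forests_uniq.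
move=> s; rewrite mem_forests inE; case: s => [|t s].
  by rewrite /forest_leaves big_nil.
rewrite forest_leaves_cons addn_eq0; case: (leaves t) (leaves_gt0 t) => //.
Qed.

(** Sort the forests by their first tree. *)
Lemma size_forests_rec k n : (0 < n)%N ->
  size (forests k n) =
  \sum_(t <- trees k | (leaves t <= n)%N) size (forests k (n - leaves t)).
Proof.
move=> n0; pose T := [seq t <- trees k | (leaves t <= n)%N].
have -> : size (forests k n) =
    size [seq t :: s | t <- T, s <- forests k (n - leaves t)].
  apply/perm_size/uniq_perm; first exact: forests_uniq.
    apply: allpairs_uniq_dep; first by rewrite filter_uniq ?trees_uniq.
      by move=> t _; exact: forests_uniq.
    by move=> [t s] [t' s'] _ _ /= [-> ->].
  move=> s; apply/idP/allpairsPdep => [|[t [r []]]].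
    case: s => [|t s].
      by rewrite mem_forests /forest_leaves big_nil eq_sym (gtn_eqF n0).
    rewrite mem_forests /= forest_leaves_cons => /and3P[/eqP en ht hs].
    exists t, s; rewrite mem_filter mem_trees ht mem_forests hs -en.
    by rewrite leq_addr addKn eqxx.
  rewrite mem_filter mem_trees mem_forests => /andP[tn ht] /andP[/eqP rn hr] ->.
  by rewrite mem_forests forest_leaves_cons rn subnKC//= eqxx ht.
by rewrite size_allpairs_dep sumnE big_map big_filter.
Qed.

(** What lies on either side of a window. *)
Definition sides (k n : nat) : seq (seq tree * seq tree) :=
  [seq (x.1, x.2) | i <- iota 0 n.+1,
                    x <- [seq (p, q) | p <- forests k i, q <- forests k (n - i)]].

Lemma mem_sides k n p q :
  ((p, q) \in sides k n) =
  [&& (forest_leaves p + forest_leaves q == n)%N,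
      all (fun t => height t <= k)%N p & all (fun t => height t <= k)%N q].
Proof.
apply/allpairsPdep/idP => [[i [[_ _] [ii /allpairsP[[p' q'] /= [hp hq [-> ->]]]]]]|].
  move=> [-> ->]; move: hp hq ii; rewrite !mem_forests mem_iota add0n ltnS.
  by move=> /andP[/eqP -> ->] /andP[/eqP -> ->] /= ii; rewrite subnKC// eqxx.
move=> /and3P[/eqP en hp hq]; exists (forest_leaves p), (p, q).
rewrite mem_iota add0n ltnS -en leq_addr; split => //.
apply/allpairsP; exists (p, q).
by rewrite /= !mem_forests hp hq addKn !eqxx.
Qed.

Lemma sides_uniq k n : uniq (sides k n).
Proof.
apply: allpairs_uniq_dep; first exact: iota_uniq.
  move=> i _; apply: allpairs_uniq; [exact: forests_uniq|exact: forests_uniq|].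
  by move=> [? ?] [? ?].
set st := flatten _.
have stP z : z \in st -> tag z = forest_leaves (tagged z).1.
  move=> /allpairsPdep[i [x [_ /allpairsP[[p q] [/= + _ ->]] ->]]].
  by rewrite mem_forests => /andP[/eqP].
move=> [i [p q]] [i' [p' q']] /stP/= -> /stP/= -> [-> ->].
by [].
Qed.

Lemma size_sides k n :
  size (sides k n) =
  \sum_(i < n.+1) (size (forests k i) * size (forests k (n - i)))%N.
Proof.
rewrite size_allpairs_dep sumnE big_map -(big_mkord xpredT
  (fun i => size (forests k i) * size (forests k (n - i)))%N) /index_iota subn0.
by apply: eq_bigr => i _; rewrite size_allpairs.
Qed.

(** * Marked forests and their windows *)

Lemma card_fset_set_uniq (T : choiceType) (S : set T) (e : seq T) :
  uniq e -> (forall x, (x \in e) <-> S x) -> #|` fset_set S| = size e.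
Proof.
move=> ue eS; have finS : finite_set S.
  by apply/finite_seqP; exists e; apply/seteqP; split => x /= /eS.
rewrite -(undup_id ue) -card_fseq; congr #|` _|; apply/fsetP => x.
by rewrite in_fset_set// !inE /=; apply/idP/idP => [/set_mem /eS|/eS /mem_set].
Qed.

Definition window_count (k n m : nat) (Q : pred (seq tree)) : nat :=
  \sum_(w <- words (trees k) m | Q w && (forest_leaves w <= n)%N)
     size (sides k (n - forest_leaves w)).

(** Cutting a marked forest around its window is a bijection onto the triples
    of a window and the two forests beside it; only the marks within [a] of the
    left end or [b] of the right end have no window. *)
Lemma count_by_window (k n a b : nat) (S : set mforest) (Q : pred (seq tree)) :
  S `<=` BB n k ->
  (forall p w r, size w = (a + b).+1 -> BB n k (p ++ w ++ r, size p + a)%N ->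
     S (p ++ w ++ r, size p + a)%N <-> Q w) ->
  (window_count k n (a + b).+1 Q <= #|` fset_set S|
     <= window_count k n (a + b).+1 Q + (a + b) * size (forests k n))%N.
Proof.
move=> SBB SQ.
pose W := [seq w <- words (trees k) (a + b).+1 | Q w && (forest_leaves w <= n)%N].
pose inner := [seq (x.1 ++ w ++ x.2, size x.1 + a)%N |
                 w <- W, x <- sides k (n - forest_leaves w)].
pose border := [seq (s, i) | s <- forests k n,
    i <- iota 0 a ++ [seq (size s - j.+1)%N | j <- iota 0 b]].
have WP w : w \in W -> [/\ size w = (a + b).+1, Q w, (forest_leaves w <= n)%N
                        & all (fun t => height t <= k)%N w].
  rewrite mem_filter mem_words => /andP[/andP[Qw wn] /andP[/eqP sw hw]].
  split => //; apply: sub_all hw => t; by rewrite /= mem_trees.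
have innerC : size inner = window_count k n (a + b).+1 Q.
  by rewrite size_allpairs_dep sumnE big_map big_filter.
have inner_uniq : uniq inner.
  apply: allpairs_uniq_dep.
  - by rewrite filter_uniq// words_uniq// trees_uniq.
  - by move=> w _; exact: sides_uniq.
  - (* All windows have the same size, so the list and the mark determine the
       two cuts. *)
    set st := flatten _.
    have stP z : z \in st -> size (tag z) = (a + b).+1.
      by move=> /allpairsPdep[i [x [/WP[+ _ _ _] _ ->]]].
    move=> [w [p r]] [w' [p' r']] /stP/= sw /stP/= sw' [+ /addIn pp].
    move=> /eqP; rewrite eqseq_cat// => /andP[/eqP -> ].
    by rewrite eqseq_cat ?sw ?sw'// => /andP[/eqP -> /eqP ->].
have innerS v : v \in inner -> S v.
  move=> /allpairsPdep[w [[p r] [/WP[sw Qw wn hw] + ->]]].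
  rewrite mem_sides => /and3P[/eqP en hp hr] /=; apply/SQ => //; split => /=.
  - by rewrite !size_cat sw; lia.
  - by rewrite -/(forest_leaves _) !forest_leaves_cat; lia.
  - by rewrite !all_cat hp hw hr.
have borderC : size border = ((a + b) * size (forests k n))%N.
  rewrite size_allpairs_dep sumnE big_map (eq_bigr (fun=> (a + b)%N)).
    by rewrite big_const_seq iter_addn_0 count_predT.
  by move=> s _; rewrite size_cat size_map !size_iota.
have finS : finite_set S by apply: sub_finite_set SBB (finite_BB _ _).
have Sin v : S v -> v \in inner ++ border.
  case: v => s i Sv; have [/= lt_is en hs] := SBB _ Sv.
  have sn : s \in forests k n by rewrite mem_forests hs andbT; apply/eqP.
  rewrite mem_cat; have [ia|ai] := ltnP i a.
    apply/orP; right; apply/allpairsPdep; exists s, i.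
    by rewrite mem_cat mem_iota /= add0n ia.
  have [ib|bi] := ltnP (i + b) (size s); last first.
    apply/orP; right; apply/allpairsPdep; exists s, i; split => //.
    rewrite mem_cat; apply/orP; right; apply/mapP; exists (size s - i.+1)%N.
      by rewrite mem_iota; lia.
    by lia.
  pose p := take (i - a) s; pose w := take (a + b).+1 (drop (i - a) s).
  pose r := drop (a + b).+1 (drop (i - a) s).
  have sE : s = p ++ w ++ r by rewrite !cat_take_drop.
  have sp : size p = (i - a)%N by rewrite size_take; case: ltnP; lia.
  have iE : i = (size p + a)%N by lia.
  have sw : size w = (a + b).+1.
    by rewrite size_take size_drop; case: ltnP; lia.
  have hw := hs; have enw := en.
  move: hw enw; rewrite sE -/(forest_leaves _) !all_cat !forest_leaves_cat.
  move=> /and3P[hp hw hr] enw.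
  apply/orP; left; apply/allpairsPdep; exists w, (p, r); split.
  - rewrite mem_filter mem_words sw eqxx -andbA; apply/and3P; split.
    + by apply/(SQ p w r) => //; rewrite -sE -iE//; exact: SBB.
    + by lia.
    + by apply: sub_all hw => t; rewrite /= mem_trees.
  - by rewrite mem_sides hp hr !andbT; lia.
  - by rewrite /= -sE -iE.
rewrite -innerC -borderC -size_cat; apply/andP; split; apply: uniq_leq_size => //.
- by move=> v /innerS Sv; rewrite in_fset_set// mem_set.
- by move=> v; rewrite in_fset_set// => /set_mem; exact: Sin.
Qed.

(** * Counting edges by their origins *)

Lemma fset2_inj (T : choiceType) (u v u' v' : T) :
  [fset u; v]%fset = [fset u'; v']%fset ->
  (u = u' /\ v = v') \/ (u = v' /\ v = u').
Proof.
move=> /fsetP e; have := e u; have := e v; have := e u'; have := e v'.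
rewrite !inE !eqxx ?orbT /= => /orP e1 /orP e2 /esym/orP e3 /esym/orP e4.
case: e1 e2 e3 e4 => /eqP e1 [] /eqP e2 [] /eqP e3 [] /eqP e4; subst;
  by [left|right].
Qed.

Definition hstep (u : mforest) : mforest := (u.1, u.2.+1).

Definition vstep (u : mforest) : mforest :=
  if nth Leaf u.1 u.2 is Node A B
  then (take u.2 u.1 ++ [:: A, B & drop u.2.+1 u.1], u.2) else u.

Lemma horizontalE u v : horizontal u v <-> v = hstep u.
Proof. by case: u v => [s i] [r j]; split => [[/= -> ->]|->]. Qed.

Lemma vstep_cat s A B r :
  vstep (s ++ Node A B :: r, size s) = (s ++ [:: A, B & r], size s).
Proof.
rewrite /vstep /= nth_cat ltnn subnn /= take_size_cat//.
by rewrite -[s ++ Node A B :: r]cat_rcons drop_size_cat ?size_rcons.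
Qed.

Lemma vertical_vstep u v : vertical u v -> v = vstep u.
Proof. by move=> [s [A [B [r [-> ->]]]]]; rewrite vstep_cat. Qed.

Lemma size_vertical u v : vertical u v -> size v.1 = (size u.1).+1.
Proof. by move=> [s [A [B [r [-> ->]]]]]; rewrite /= !size_cat /= !addnS. Qed.

Definition horizontal_edges (Y : set mforest) : set mforest :=
  [set u | Y u /\ Y (hstep u)].

Definition vertical_edges (Y : set mforest) : set mforest :=
  [set u | [/\ Y u, vertical u (vstep u) & Y (vstep u)]].

(** An edge is recovered from its origin and its direction: a horizontal edge
    keeps the forest and moves the mark, a vertical one changes the number of
    trees. *)
Lemma card_edges (Y : set mforest) : finite_set Y ->
  #|` fset_set (edges Y)| =
  (#|` fset_set (horizontal_edges Y)| + #|` fset_set (vertical_edges Y)|)%N.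
Proof.
move=> finY.
have finH : finite_set (horizontal_edges Y) by apply: sub_finite_set finY => u [].
have finV : finite_set (vertical_edges Y) by apply: sub_finite_set finY => u [].
pose H := enum_fset (fset_set (horizontal_edges Y)).
pose V := enum_fset (fset_set (vertical_edges Y)).
have HP u : u \in H <-> horizontal_edges Y u.
  by rewrite in_fset_set//; split => [/set_mem|/mem_set].
have VP u : u \in V <-> vertical_edges Y u.
  by rewrite in_fset_set//; split => [/set_mem|/mem_set].
rewrite (@card_fset_set_uniq _ _ ([seq [fset u; hstep u]%fset | u <- H] ++
    [seq [fset u; vstep u]%fset | u <- V])); first by rewrite size_cat !size_map.
  rewrite cat_uniq; apply/and3P; split.
  - rewrite map_inj_in_uniq ?fset_uniq// => u u' _ _ /fset2_inj[[]//|[]].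
    by case: u u' => [s i] [r j] [_ ij] [_ ji]; lia.
  - apply/hasPn => _ /mapP[u /VP[_ uv _] ->]; apply/mapP => -[u' _].
    have := size_vertical uv.
    by move=> + /fset2_inj[[e1 e2]|[e1 e2]]; rewrite e2 e1 /=; lia.
  - rewrite map_inj_in_uniq ?fset_uniq// => u u' /VP[_ uv _] /VP[_ uv' _].
    move: (size_vertical uv) (size_vertical uv') => e e'.
    by move=> /fset2_inj[[]//|[uE uE']]; move: e e'; rewrite -uE -uE'; lia.
move=> e; rewrite mem_cat; split.
  move=> /orP[/mapP[u /HP[Yu Yh] ->]|/mapP[u /VP[Yu uv Yv] ->]].
    by exists u, (hstep u); split => //; apply: Or41; apply/horizontalE.
  by exists u, (vstep u); split => //; apply: Or43.
move=> [u [v [Yu Yv uv ->]]]; case: uv => [/horizontalE e1|/horizontalE e1|e1|e1].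
- by subst v; rewrite (map_f (fun u => [fset u; hstep u]%fset))//; apply/HP.
- subst u; rewrite fsetUC (map_f (fun u => [fset u; hstep u]%fset))//.
  exact/HP.
- have e2 := vertical_vstep e1; subst v.
  by rewrite orbC (map_f (fun u => [fset u; vstep u]%fset))//; apply/VP.
- have e2 := vertical_vstep e1; subst u.
  by rewrite fsetUC orbC (map_f (fun u => [fset u; vstep u]%fset))//; apply/VP.
Qed.

(** * Retention and edges read off the window *)

Definition allowed (a b : nat) (U : set (word a b)) (o : seq category) : bool :=
  `[< exists2 w : word a b, tval w = o & U w >].

Lemma vtype_window a b (c : boundary_convention a b) k p w r :
  size w = (a + b).+1 ->
  omap (@tval _ _) (vtype c k (p ++ w ++ r, size p + a)%N) =
  Some (map (cat_of k) w).
Proof.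
move=> sw; rewrite /vtype /= leq_addl !size_cat sw /=.
have -> : (size p + a + b < size p + ((a + b).+1 + size r))%N by lia.
congr Some; apply: (@eq_from_nth _ CE) => [|i]; rewrite size_tuple ?size_map//.
move=> ib; rewrite -[i]/(nat_of_ord (Ordinal ib)) nth_mktuple /=.
rewrite (nth_map Leaf) ?sw//; congr cat_of.
have -> : (size p + a + i - a = size p + i)%N by lia.
by rewrite nth_cat ltnNge leq_addr /= addKn nth_cat sw ib.
Qed.

(** Whatever the convention at the ends of the forest, a mark with a complete
    window is judged by the categories of that window. *)
Lemma retained_window a b (c : boundary_convention a b) U n k p w r :
  size w = (a + b).+1 -> BB n k (p ++ w ++ r, size p + a)%N ->
  retained c U n k (p ++ w ++ r, size p + a)%N <-> allowed U (map (cat_of k) w).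
Proof.
move=> sw hBB; have := vtype_window c k p r sw.
case e : (vtype _ _ _) => [z|//] /= [zE]; split => [[_ [z']]|/asboolP[z' z'E Uz']].
  by rewrite e => -[<-] Uz; apply/asboolP; exists z.
split => //; exists z' => //; rewrite e; congr Some; apply: val_inj.
by rewrite /= zE -z'E.
Qed.

Definition horizontal_window (a : nat) (U : set (word a 1)) (k : nat) (w : seq tree) :=
  allowed U (map (cat_of k) (take (a + 1).+1 w)) &&
  allowed U (map (cat_of k) (behead w)).

Lemma horizontal_edges_window a (c : boundary_convention a 1) U n k p w r :
  size w = (a + 2).+1 -> BB n k (p ++ w ++ r, size p + a)%N ->
  horizontal_edges (retained c U n k) (p ++ w ++ r, size p + a)%N <->
  horizontal_window U k w.
Proof.
move=> sw hBB; rewrite /horizontal_edges /horizontal_window /hstep /=.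
have e1 : p ++ w ++ r = p ++ take (a + 1).+1 w ++ (drop (a + 1).+1 w ++ r).
  by rewrite (catA (take _ _)) cat_take_drop.
have R1 : retained c U n k (p ++ w ++ r, (size p + a)%N) <->
    allowed U (map (cat_of k) (take (a + 1).+1 w)).
  by rewrite e1; apply: retained_window; rewrite ?size_takel ?sw -?e1//; lia.
case: w sw hBB {e1} R1 => [|t w] //= [sw] hBB R1.
have e2 : p ++ t :: w ++ r = rcons p t ++ w ++ r by rewrite cat_rcons.
have e3 : ((size p + a).+1 = size (rcons p t) + a)%N by rewrite size_rcons.
have R2 : retained c U n k (p ++ t :: w ++ r, (size p + a).+1) <->
    allowed U (map (cat_of k) w).
  rewrite e2 e3; apply: retained_window; rewrite -?e2 -?e3; first by lia.
  by case: hBB => /= _ en hs; split => //=; rewrite !size_cat /= size_cat; lia.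
by split => [[/R1 -> /R2 ->]|/andP[/R1 ? /R2 ?]].
Qed.

Definition vertical_window (a : nat) (U : set (word a 1)) (k : nat) (w : seq tree) :=
  allowed U (map (cat_of k) w) &&
  if nth Leaf w a is Node A B
  then allowed U (map (cat_of k) (take a w ++ [:: A; B])) else false.

(** The split puts the two children at the positions of the marked tree and of
    its right neighbour, so that its window ends with them. *)
Lemma vertical_edges_window a (c : boundary_convention a 1) U n k p w r :
  size w = (a + 1).+1 -> BB n k (p ++ w ++ r, size p + a)%N ->
  vertical_edges (retained c U n k) (p ++ w ++ r, size p + a)%N <->
  vertical_window U k w.
Proof.
move=> sw hBB; have R1 := retained_window c U sw hBB.
have [x [t [y [wE sx]]]] : exists x t y, w = x ++ [:: t; y] /\ size x = a.
  exists (take a w), (nth Leaf w a), (nth Leaf w a.+1).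
  rewrite size_takel ?sw; last by lia.
  split => //; rewrite -[LHS](cat_take_drop a); congr (_ ++ _).
  rewrite (drop_nth Leaf) ?sw; last by lia.
  rewrite (drop_nth Leaf) ?sw; last by lia.
  by rewrite drop_oversize// sw; lia.
rewrite /vertical_edges /vertical_window /=.
have -> : nth Leaf w a = t by rewrite wE nth_cat sx ltnn subnn.
have -> : take a w = x by rewrite wE take_size_cat.
have sE : p ++ w ++ r = (p ++ x) ++ t :: (y :: r) by rewrite wE -!catA.
have mE : (size p + a = size (p ++ x))%N by rewrite size_cat sx.
have [At|[A [B tE]]] : t = Leaf \/ exists A B, t = Node A B.
- by case: t {sE wE} => [|A B]; [left|right; exists A, B].
- rewrite At andbF; split => // -[_ + _]; rewrite sE mE At.
  move=> [s [A [B [q [[e1 e2]]]]]] _; have := congr1 (nth Leaf ^~ (size s)) e1.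
  by rewrite -{1}e2 !nth_cat !ltnn !subnn.
have vE : vstep (p ++ w ++ r, size p + a)%N =
    (p ++ (x ++ [:: A; B]) ++ (y :: r), size p + a)%N.
  by rewrite sE mE tE vstep_cat -!catA.
have vert : vertical (p ++ w ++ r, size p + a)%N (vstep (p ++ w ++ r, size p + a)%N).
  by rewrite sE mE tE vstep_cat; exists (p ++ x), A, B, (y :: r).
have R2 : retained c U n k (vstep (p ++ w ++ r, size p + a)%N) <->
    allowed U (map (cat_of k) (x ++ [:: A; B])).
  rewrite vE; apply: retained_window; first by rewrite size_cat sx addn1 addn2.
  case: hBB => /= _; rewrite sE tE -!/(forest_leaves _) !forest_leaves_cat.
  rewrite !all_cat /= !forest_leaves_cons => en.
  move=> /andP[/andP[hp hx] /and3P[hAB hy hr]]; split => /=.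
  - by rewrite !size_cat sx /=; lia.
  - rewrite -/(forest_leaves _) !forest_leaves_cat !forest_leaves_cons.
    by rewrite /(forest_leaves [::]) big_nil -en [leaves (Node _ _)]/=; lia.
  - by rewrite !all_cat /= hp hx hy hr; move: hAB; rewrite /=; lia.
by rewrite tE; split => [[/R1 -> _ /R2 ->]|/andP[/R1 ? /R2 ?]].
Qed.

(** * A renewal theorem *)

(** The element [t0] makes a step of length one, so that a value above the lower
    bound [x] pulls up its successor by the fraction [W t0] of the excess.  The
    next [M] values keep at least the part [W t0 ^+ M] of the excess, and every
    later value is an average of values that do. *)
Lemma renewal_lower_bound (R : realType) (T : eqType) (A : seq T) (l : T -> nat)
    (W : T -> R) (M : nat) (t0 : T) (v : nat -> R) (N : nat) (x z : R) :
  (forall t, t \in A -> (0 < l t <= M)%N) -> (forall t, 0 <= W t) ->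
  \sum_(t <- A) W t = 1 -> t0 \in A -> l t0 = 1%N ->
  (forall n, (M <= n)%N -> v n = \sum_(t <- A) W t * v (n - l t)%N) ->
  (forall j, (N <= j)%N -> x <= v j) -> x <= z -> z <= v (N + M).-1 ->
  forall j, (N + M <= j)%N -> x + W t0 ^+ M * (z - x) <= v j.
Proof.
move=> lM W0 W1 At0 lt0 rec xv xz zv.
have M0 : (0 < M)%N by have /andP[] := lM _ At0; exact: leq_trans.
have vW n y : (M <= n)%N -> v n - y = \sum_(t <- A) W t * (v (n - l t)%N - y).
  move=> Mn; under eq_bigr do rewrite mulrBr.
  by rewrite sumrB -rec// -mulr_suml W1 mul1r.
have w01 : W t0 <= 1.
  by rewrite -W1 (big_rem t0)//= lerDl sumr_ge0.
have pull i : (i <= M)%N -> x + W t0 ^+ i * (z - x) <= v ((N + M).-1 + i)%N.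
  elim: i => [_|i IH iM]; first by rewrite expr0 mul1r addn0; lra.
  (* Every step from here is at most [M] long, hence ends at [N] or later. *)
  rewrite -lerBrDl vW; last by lia.
  rewrite (big_rem t0)//= lt0 -[leLHS]addr0; apply: lerD.
    rewrite exprS -mulrA ler_wpM2l// lerBrDl.
    by rewrite addnS subn1 /= IH// ltnW.
  rewrite big_seq sumr_ge0// => t /mem_rem /lM ltM.
  by rewrite mulr_ge0// subr_ge0 xv//; lia.
move=> j; elim/ltn_ind: j => j IH Nj.
have [jM|jM] := leqP j (N + M + M).-1.
  have iM : (j - (N + M).-1 <= M)%N by lia.
  have := pull _ iM; rewrite subnKC; last by lia.
  apply: le_trans; rewrite lerD2l ler_wpM2r ?subr_ge0// ler_wiXn2l//; lia.
rewrite -subr_ge0 vW; last by lia.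
rewrite big_seq sumr_ge0// => t /lM ltM.
by rewrite mulr_ge0// subr_ge0 IH//; lia.
Qed.

(** Of the two halves of the current range, the last value of the window lies in
    one, which pulls the opposite end of the range towards it. *)
Lemma renewal_oscillation (R : realType) (T : eqType) (A : seq T) (l : T -> nat)
    (W : T -> R) (M : nat) (t0 : T) (v : nat -> R) :
  (forall t, t \in A -> (0 < l t <= M)%N) -> (forall t, 0 <= W t) ->
  \sum_(t <- A) W t = 1 -> t0 \in A -> l t0 = 1%N -> (forall n, 0 <= v n <= 1) ->
  (forall n, (M <= n)%N -> v n = \sum_(t <- A) W t * v (n - l t)%N) ->
  forall r, exists x, forall j, (r * M <= j)%N ->
    x <= v j <= x + (1 - W t0 ^+ M / 2) ^+ r.
Proof.
move=> lM W0 W1 At0 lt0 v01 rec.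
elim=> [|r [x xP]]; first by exists 0 => j _; rewrite expr0 add0r v01.
set d := (1 - _) ^+ r in xP *.
have [lo|up] := leP (x + d / 2) (v (r * M + M).-1).
  exists (x + W t0 ^+ M * (d / 2)) => j jr; apply/andP; split.
    have := renewal_lower_bound lM W0 W1 At0 lt0 rec (N := r * M) (x := x)
      (z := x + d / 2); rewrite addrAC subrr add0r; apply => //.
    - by move=> i /xP/andP[].
    - by have /xP := leqnn (r * M); lra.
    - by lia.
  have /xP/andP[_] : (r * M <= j)%N by lia.
  by move=> /le_trans; apply; rewrite exprS -/d; lra.
exists x => j jr; apply/andP; split.
  by have /xP/andP[] : (r * M <= j)%N by lia.
have := @renewal_lower_bound _ _ A l W M t0 (fun n => - v n) (r * M) (- (x + d))
  (- (x + d / 2)) lM W0 W1 At0 lt0.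
have -> : - (x + d / 2) - - (x + d) = d / 2 by lra.
move=> H; rewrite exprS -/d.
have : - (x + d) + W t0 ^+ M * (d / 2) <= - v j.
  apply: H => //.
  - by move=> n Mn; rewrite rec// -sumrN; apply: eq_bigr => t _; rewrite mulrN.
  - by move=> i /xP/andP[_]; rewrite lerN2.
  - by have /xP := leqnn (r * M); lra.
  - by rewrite lerN2 ltW.
  - by lia.
by lra.
Qed.

Lemma renewal_increments (R : realType) (T : eqType) (A : seq T) (l : T -> nat)
    (W : T -> R) (M : nat) (t0 : T) (v : nat -> R) :
  (forall t, t \in A -> (0 < l t <= M)%N) -> (forall t, 0 <= W t) ->
  \sum_(t <- A) W t = 1 -> t0 \in A -> l t0 = 1%N -> 0 < W t0 ->
  (forall n, 0 <= v n <= 1) ->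
  (forall n, (M <= n)%N -> v n = \sum_(t <- A) W t * v (n - l t)%N) ->
  `|v n.+1 - v n| @[n --> \oo] --> (0 : R).
Proof.
move=> lM W0 W1 At0 lt0 w0 v01 rec.
have osc := renewal_oscillation lM W0 W1 At0 lt0 v01 rec.
have w01 : W t0 <= 1.
  by rewrite -W1 (big_rem t0)//= lerDl sumr_ge0.
have wM0 : 0 < W t0 ^+ M by rewrite exprn_gt0.
have wM1 : W t0 ^+ M <= 1 by rewrite exprn_ile1// ltW.
pose rho := 1 - W t0 ^+ M / 2.
have rho1 : `|rho| < 1 by rewrite ger0_norm /rho; lra.
apply/cvgrPdist_lt => e e0.
have /cvgrPdist_lt/(_ e e0) [r _ rP] := cvg_expr rho1.
have {rP} := rP r (leqnn r); rewrite /= sub0r normrN => rP.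
have [x xP] := osc r.
exists (r * M)%N => // n /= rn.
have /andP[h1 h2] := xP _ rn; have /andP[h3 h4] := xP _ (leqW rn).
rewrite sub0r normrN normr_id; apply: le_lt_trans rP.
rewrite -/rho in h2 h4; apply: (le_trans _ (ler_norm _)).
by rewrite ler_norml; lra.
Qed.

(** A run of steps of length one bounds [v n] below for [n <= M], and averaging
    carries this bound further. *)
Lemma renewal_bounds (R : realType) (T : eqType) (A : seq T) (l : T -> nat)
    (W : T -> R) (M : nat) (t0 : T) (v : nat -> R) :
  (forall t, t \in A -> (0 < l t <= M)%N) -> (forall t, 0 <= W t) ->
  \sum_(t <- A) W t = 1 -> t0 \in A -> l t0 = 1%N -> v 0%N = 1 ->
  (forall n, (0 < n)%N ->
     v n = \sum_(t <- A | (l t <= n)%N) W t * v (n - l t)%N) ->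
  forall n, W t0 ^+ M <= v n <= 1.
Proof.
move=> lM W0 W1 At0 lt0 v0 rec.
have w01 : W t0 <= 1.
  by rewrite -W1 (big_rem t0)//= lerDl sumr_ge0.
have v_ge0 n : 0 <= v n.
  elim/ltn_ind: n => -[|n] IH; first by rewrite v0.
  rewrite rec// big_seq_cond sumr_ge0// => t /andP[/lM tM tn].
  by rewrite mulr_ge0// IH//; lia.
have v_le1 n : v n <= 1.
  elim/ltn_ind: n => -[|n] IH; first by rewrite v0.
  rewrite rec// -W1 [leRHS](bigID (fun t => (l t <= n.+1)%N))/=.
  rewrite -[leLHS]addr0 lerD ?sumr_ge0// big_seq_cond [leRHS]big_seq_cond.
  apply: ler_sum => t /andP[/lM tM tn].
  by rewrite -[leRHS]mulr1 ler_wpM2l// IH//; lia.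
have v_pow n : W t0 ^+ n <= v n.
  elim: n => [|n IH]; first by rewrite v0.
  rewrite rec// (big_rem t0)//= lt0 /= -[leLHS]addr0 lerD//.
    by rewrite exprS subn1 ler_wpM2l.
  by rewrite sumr_ge0// => t _; rewrite mulr_ge0.
move=> n; rewrite v_le1 andbT; elim/ltn_ind: n => n IH.
have [nM|Mn] := leqP n M.
  by apply: le_trans (v_pow n); rewrite ler_wiXn2l.
rewrite rec; last by lia.
rewrite -[leLHS]mul1r -W1 mulr_suml big_seq [leRHS]big_seq_cond.
rewrite [leRHS](eq_bigl (fun t => t \in A)); last first.
  by move=> t; apply: andb_idr => /lM; lia.
apply: ler_sum => t /lM tM.
by rewrite ler_wpM2l// IH//; lia.
Qed.

Definition self_convolution (R : realType) (u : nat -> R) (n : nat) : R :=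
  \sum_(i < n.+1) u i * u (n - i)%N.

Lemma self_convolution_ge (R : realType) (u : nat -> R) (c : R) n :
  0 < c -> (forall n, c <= u n <= 1) -> c ^+ 2 * n.+1%:R <= self_convolution u n.
Proof.
move=> c0 cu; rewrite /self_convolution.
have -> : c ^+ 2 * n.+1%:R = \sum_(i < n.+1) c * c.
  by rewrite sumr_const card_ord -expr2 mulr_natr.
have cl j : c <= u j by have /andP[] := cu j.
by apply: ler_sum => i _; apply: ler_pM; rewrite ?cl ?ltW.
Qed.

Lemma self_convolution_gt0 (R : realType) (u : nat -> R) (c : R) n :
  0 < c -> (forall n, c <= u n <= 1) -> 0 < self_convolution u n.
Proof.
move=> c0 cu; apply: lt_le_trans (self_convolution_ge _ c0 cu).
by rewrite mulr_gt0// exprn_gt0.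
Qed.

(** The convolution grows at least linearly while its increments are the sums
    of the increments of [u], which are [o(n)] by Cesaro's theorem. *)
Lemma self_convolution_ratio (R : realType) (u : nat -> R) (c : R) :
  0 < c -> (forall n, c <= u n <= 1) ->
  `|u n.+1 - u n| @[n --> \oo] --> (0 : R) ->
  self_convolution u n / self_convolution u n.+1 @[n --> \oo] --> (1 : R).
Proof.
move=> c0 cu d0; set V := self_convolution u.
have V0 n : 0 < V n by exact: self_convolution_gt0 cu.
have u0 n : 0 <= u n by have /andP[+ _] := cu n; apply: le_trans; exact: ltW.
have u1 n : u n <= 1 by have /andP[] := cu n.
pose d n := `|u n.+1 - u n|.
have dV n : `|V n.+1 - V n| <= \sum_(0 <= i < n.+1) d i + 1.
  rewrite /V /self_convolution big_ord_recr/= subnn addrAC -sumrB.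
  apply: le_trans (ler_normD _ _) _; apply: lerD; last first.
    by rewrite ger0_norm ?mulr_ge0// mulr_ile1.
  apply: le_trans (ler_norm_sum _ _ _) _.
  rewrite big_mkord [leRHS](reindex_inj rev_ord_inj)/=; apply: ler_sum => i _.
  rewrite -mulrBr normrM subSS subSn; last by rewrite -ltnS.
  by rewrite ler_piMl// ger0_norm.
pose h n := c ^- 2 * (n.+1%:R^-1 * \sum_(0 <= i < n.+1) d i + n.+1%:R^-1).
have h0 : h n @[n --> \oo] --> (0 : R).
  have h1 : n.+1%:R^-1 * \sum_(0 <= i < n.+1) d i @[n --> \oo] --> (0 : R).
    exact: (cesaro d0).
  have h2 : (n.+1%:R^-1 : R) @[n --> \oo] --> (0 : R) by exact: cvg_harmonic.
  by have := cvgM (cvg_cst (c ^- 2)) (cvgD h1 h2); rewrite addr0 mulr0; exact.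
apply/cvgrPdist_le => e e0.
near=> n.
have : `|h n| <= e.
  by near: n; move/cvgrPdist_le : h0 => /(_ e e0); apply: filterS => n;
    rewrite sub0r normrN.
apply: le_trans; rewrite -[X in X - _](@mulfV _ (V n.+1)) ?gt_eqF// -mulrBl normrM.
rewrite (gtr0_norm (x := (V n.+1)^-1)) ?invr_gt0// ler_pdivrMr//.
apply: le_trans (dV n) _; apply: le_trans (ler_wpM2l (normr_ge0 _)
   (self_convolution_ge n.+1 c0 cu)).
have hE : c ^+ 2 * n.+1%:R * h n = \sum_(0 <= i < n.+1) d i + 1.
  rewrite /h; move: (\sum_(_ <= _ < _) _) => S; field.
  by rewrite nat1r pnatr_eq0 /= gt_eqF.
have hn0 : 0 <= h n.
  apply: mulr_ge0; first by rewrite invr_ge0 exprn_ge0// ltW.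
  by rewrite addr_ge0 ?mulr_ge0 ?invr_ge0// sumr_ge0// => i _; exact: normr_ge0.
rewrite -hE ger0_norm// mulrC ler_wpM2l// ler_wpM2l ?exprn_ge0 ?ltW//.
by rewrite ltr_nat.
Unshelve. all: by end_near.
Qed.

Lemma self_convolution_ratio_shift (R : realType) (u : nat -> R) (c : R) j :
  0 < c -> (forall n, c <= u n <= 1) ->
  `|u n.+1 - u n| @[n --> \oo] --> (0 : R) ->
  self_convolution u (n - j)%N / self_convolution u n @[n --> \oo] --> (1 : R).
Proof.
move=> c0 cu d0; set V := self_convolution u.
have V0 n : 0 < V n by exact: self_convolution_gt0 cu.
rewrite -(cvg_shiftn j) /=.
have -> : (fun n => V (n + j - j)%N / V (n + j)%N) = (fun n => V n / V (n + j)%N).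
  by apply/funext => n; rewrite addnK.
elim: j => [|j IH].
  have -> : (fun n => V n / V (n + 0)%N) = cst 1.
    by apply/funext => n; rewrite addn0 mulfV ?gt_eqF.
  exact: cvg_cst.
rewrite -[1 : R]mulr1.
have -> : (fun n => V n / V (n + j.+1)%N) =
    (fun n => (V n / V (n + j)%N) * (V (n + j)%N / V (n + j).+1)).
  by apply/funext => n; rewrite addnS mulrA mulfVK ?gt_eqF.
apply: cvgM => //.
have := self_convolution_ratio c0 cu d0.
by rewrite -(cvg_shiftn j).
Qed.

Lemma self_convolution_dominates (R : realType) (u : nat -> R) (c : R) :
  0 < c -> (forall n, c <= u n <= 1) ->
  u n / self_convolution u n @[n --> \oo] --> (0 : R).
Proof.
move=> c0 cu; set V := self_convolution u.
have V0 n : 0 < V n by exact: self_convolution_gt0 cu.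
have u0 n : 0 <= u n by have /andP[+ _] := cu n; apply: le_trans; exact: ltW.
have h0 : c ^- 2 * n.+1%:R^-1 @[n --> \oo] --> (0 : R).
  have h2 : (n.+1%:R^-1 : R) @[n --> \oo] --> (0 : R) by exact: cvg_harmonic.
  by have := cvgM (cvg_cst (c ^- 2)) h2; rewrite mulr0; exact.
apply: squeeze_cvgr (cvg_cst 0) h0; near=> n.
have cn : 0 < c ^+ 2 * n.+1%:R by rewrite mulr_gt0 ?exprn_gt0.
apply/andP; split; first by rewrite divr_ge0// ltW.
rewrite ler_pdivrMr//; apply: le_trans (_ : 1 <= _); first by have /andP[] := cu n.
rewrite -invfM mulrC ler_pdivlMr ?mul1r//.
exact: self_convolution_ge.
Unshelve. all: by end_near.
Qed.

(** * Limits of the counts as the number of leaves grows *)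

Section ForestCounts.
Variables (R : realType) (k : nat) (lam : R).
Hypotheses (lam0 : 0 < lam) (lam1 : \sum_(t <- trees k) lam ^+ leaves t = 1).

(* Normalised by the growth rate, the numbers of forests form a renewal sequence
   with the trees as steps, of length their number of leaves. *)
Let u n : R := (size (forests k n))%:R * lam ^+ n.

Let M := \max_(t <- trees k) leaves t.

Lemma leaves_trees_bounds t : t \in trees k -> (0 < leaves t <= M)%N.
Proof. by move=> kt; rewrite leaves_gt0 /M; exact: leq_bigmax_seq. Qed.

Let recu n : (0 < n)%N ->
  u n = \sum_(t <- trees k | (leaves t <= n)%N) lam ^+ leaves t * u (n - leaves t)%N.
Proof.
move=> n0; rewrite /u size_forests_rec// natr_sum mulr_suml.
apply: eq_bigr => t tn; rewrite mulrCA -exprD.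
by rewrite subnKC.
Qed.

Let leaf_trees : Leaf \in trees k. Proof. by rewrite mem_trees. Qed.

Let u_bounds : exists2 c : R, 0 < c & forall n, c <= u n <= 1.
Proof.
exists (lam ^+ M); first by rewrite exprn_gt0.
move=> n; have := @renewal_bounds R _ (trees k) leaves (fun t => lam ^+ leaves t)
  M Leaf u leaves_trees_bounds _ lam1 leaf_trees erefl; apply => //.
- by move=> t; rewrite exprn_ge0// ltW.
- by rewrite /u size_forests0 mul1r expr0.
Qed.

Let u_increments : `|u n.+1 - u n| @[n --> \oo] --> (0 : R).
Proof.
have [c c0 cu] := u_bounds.
apply: (@renewal_increments R _ (trees k) leaves (fun t => lam ^+ leaves t)
  M Leaf u leaves_trees_bounds _ lam1 leaf_trees erefl) => //.
- by move=> t; rewrite exprn_ge0// ltW.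
- by move=> n; have /andP[cn ->] := cu n; rewrite andbT (le_trans _ cn)// ltW.
- move=> n Mn; rewrite recu; last first.
    by apply: leq_trans Mn; have /leaves_trees_bounds/andP[_] := leaf_trees.
  rewrite big_seq_cond [RHS]big_seq; apply: eq_bigl => t.
  by apply: andb_idr => /leaves_trees_bounds/andP[_ tM]; exact: leq_trans Mn.
Qed.

Let size_sidesE n : (size (sides k n))%:R * lam ^+ n = self_convolution u n.
Proof.
rewrite size_sides natr_sum mulr_suml; apply: eq_bigr => i _.
rewrite /u natrM -!mulrA; congr (_ * _); rewrite mulrCA -exprD subnKC//.
by rewrite -ltnS.
Qed.

Lemma size_sides_gt0 n : 0 < (size (sides k n))%:R :> R.
Proof.
have [c c0 cu] := u_bounds.
by rewrite -(@pmulr_lgt0 _ (lam ^+ n)) ?exprn_gt0// size_sidesE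
  (self_convolution_gt0 _ c0 cu).
Qed.

Lemma size_sides_shift j :
  (if (j <= n)%N then (size (sides k (n - j)))%:R / (size (sides k n))%:R else 0)
    @[n --> \oo] --> lam ^+ j.
Proof.
have [c c0 cu] := u_bounds.
have : lam ^+ j * (self_convolution u (n - j)%N / self_convolution u n)
    @[n --> \oo] --> lam ^+ j * 1.
  apply: cvgM; first exact: cvg_cst.
  exact: self_convolution_ratio_shift cu u_increments.
rewrite mulr1; apply: cvg_trans; apply: near_eq_cvg; near=> n.
have jn : (j <= n)%N by near: n; exact: nbhs_infty_ge.
rewrite jn /= -!size_sidesE -[in X in _ / (_ * X)](subnK jn) exprD.
by field; rewrite !expf_neq0 ?gt_eqF// size_sides_gt0.
Unshelve. all: by end_near.
Qed.

Lemma size_forests_negligible :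
  (size (forests k n))%:R / (size (sides k n))%:R @[n --> \oo] --> (0 : R).
Proof.
have [c c0 cu] := u_bounds.
have := self_convolution_dominates c0 cu; apply: cvg_trans.
apply: near_eq_cvg; near=> n.
rewrite -size_sidesE /u; field.
by rewrite !expf_neq0 ?gt_eqF// size_sides_gt0.
Unshelve. all: by end_near.
Qed.

(** The probability that independent trees form a window in [Q]. *)
Definition window_mass (m : nat) (Q : pred (seq tree)) : R :=
  \sum_(w <- words (trees k) m | Q w) lam ^+ forest_leaves w.

Lemma window_count_limit m Q :
  (window_count k n m Q)%:R / (size (sides k n))%:R @[n --> \oo] --> window_mass m Q.
Proof.
have e n : (window_count k n m Q)%:R / (size (sides k n))%:R =
   \sum_(w <- words (trees k) m | Q w)
      (if (forest_leaves w <= n)%N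
       then (size (sides k (n - forest_leaves w)))%:R / (size (sides k n))%:R
       else 0) :> R.
  by rewrite /window_count natr_sum mulr_suml -big_mkcondr.
rewrite (funext e).
apply: cvg_big => [|w _]; first exact: add_continuous.
exact: size_sides_shift.
Qed.

(** Boundary effects are at most [a + b] per forest, and the marked forests
    outnumber the forests by a factor that tends to infinity. *)
Lemma card_limit (a b : nat) (S : nat -> set mforest) (Q : pred (seq tree)) :
  (forall n, S n `<=` BB n k) ->
  (forall n p w r, size w = (a + b).+1 -> BB n k (p ++ w ++ r, size p + a)%N ->
     S n (p ++ w ++ r, size p + a)%N <-> Q w) ->
  #|` fset_set (S n)|%:R / (size (sides k n))%:R @[n --> \oo]
    --> window_mass (a + b).+1 Q.
Proof.
move=> SBB SQ; have h1 := @window_count_limit (a + b).+1 Q.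
have h2 : (window_count k n (a + b).+1 Q)%:R / (size (sides k n))%:R +
    (a + b)%:R * ((size (forests k n))%:R / (size (sides k n))%:R)
    @[n --> \oo] --> window_mass (a + b).+1 Q + (a + b)%:R * 0.
  apply: cvgD => //; apply: cvgM; first exact: cvg_cst.
  exact: size_forests_negligible.
rewrite mulr0 addr0 in h2.
apply: squeeze_cvgr h1 h2; near=> n.
have /andP[lo up] := count_by_window (SBB n) (SQ n).
have N0 := size_sides_gt0 n.
rewrite ler_pM2r ?invr_gt0// ler_nat lo /=.
rewrite mulrA -mulrDl ler_pM2r ?invr_gt0//.
by rewrite -natrM -natrD ler_nat.
Unshelve. all: by end_near.
Qed.

Lemma dens_limit (a : nat) (c : boundary_convention a 1) (U : set (word a 1)) :
  let mass := window_mass (a + 1).+1 (fun w => allowed U (map (cat_of k) w)) in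
  0 < mass ->
  dens R (retained c U n k) @[n --> \oo] -->
    2 * (window_mass (a + 2).+1 (horizontal_window U k) +
         window_mass (a + 1).+1 (vertical_window U k)) / mass.
Proof.
move=> mass mass0; set Y := retained c U ^~ k.
have YBB n : Y n `<=` BB n k by move=> v [].
have hY : #|` fset_set (Y n)|%:R / (size (sides k n))%:R @[n --> \oo] --> mass.
  apply: card_limit => // n p w r sw hBB; exact: retained_window.
have hH : #|` fset_set (horizontal_edges (Y n))|%:R / (size (sides k n))%:R
    @[n --> \oo] --> window_mass (a + 2).+1 (horizontal_window U k).
  apply: card_limit => [n v [/YBB]//|n p w r sw hBB].
  exact: horizontal_edges_window.
have hV : #|` fset_set (vertical_edges (Y n))|%:R / (size (sides k n))%:R
    @[n --> \oo] --> window_mass (a + 1).+1 (vertical_window U k).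
  apply: card_limit => [n v [/YBB]//|n p w r sw hBB].
  exact: vertical_edges_window.
pose N n : R := (size (sides k n))%:R.
have : 2 * (#|` fset_set (horizontal_edges (Y n))|%:R / N n +
            #|` fset_set (vertical_edges (Y n))|%:R / N n) /
    (#|` fset_set (Y n)|%:R / N n) @[n --> \oo] -->
    2 * (window_mass (a + 2).+1 (horizontal_window U k) +
         window_mass (a + 1).+1 (vertical_window U k)) / mass.
  apply: cvgM; last by apply: cvgV => //; exact: lt0r_neq0.
  by apply: cvgM; [exact: cvg_cst|exact: cvgD].
apply: cvg_trans; apply: near_eq_cvg; near=> n.
have N0 := size_sides_gt0 n.
have finY : finite_set (Y n) by apply: sub_finite_set (YBB n) (finite_BB _ _).
rewrite /dens /= card_edges// natrD -mulrDl invf_div !mulrA.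
by rewrite mulfVK ?gt_eqF.
Unshelve. all: by end_near.
Qed.

End ForestCounts.

(** * Sums over independent letters *)

(** The expectation of [f] at a word of [m] independent letters of [A] drawn with
    the weights [W]. *)
Definition wsum (R : comNzRingType) (T : Type) (A : seq T) (W : T -> R) (m : nat)
    (f : seq T -> R) : R :=
  \sum_(w <- words A m) (\prod_(t <- w) W t) * f w.

Lemma wsum0 (R : comNzRingType) (T : Type) (A : seq T) (W : T -> R) f :
  wsum A W 0 f = f [::].
Proof. by rewrite /wsum /= big_seq1 big_nil mul1r. Qed.

Lemma wsumS (R : comNzRingType) (T : Type) (A : seq T) (W : T -> R) m f :
  wsum A W m.+1 f = \sum_(t <- A) W t * wsum A W m (fun w => f (t :: w)).
Proof.
rewrite /wsum /= big_allpairs_dep; apply: eq_bigr => t _; rewrite mulr_sumr.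
by apply: eq_bigr => w _; rewrite big_cons mulrA.
Qed.

Lemma eq_wsum (R : comNzRingType) (T : Type) (A : seq T) (W : T -> R) m f g :
  (forall w, size w = m -> f w = g w) -> wsum A W m f = wsum A W m g.
Proof.
elim: m f g => [|m IH] f g fg; first by rewrite !wsum0 fg.
rewrite !wsumS; apply: eq_bigr => t _; congr (_ * _); apply: IH => w sw.
by rewrite fg//= sw.
Qed.

Lemma wsumSl (R : comNzRingType) (T : Type) (A : seq T) (W : T -> R) m f :
  wsum A W m.+1 f = wsum A W m (fun w => \sum_(t <- A) W t * f (t :: w)).
Proof.
rewrite wsumS /wsum [LHS](eq_bigr _ (fun t _ => mulr_sumr _ _ _ _)) exchange_big.
by apply: eq_bigr => w _; rewrite mulr_sumr; apply: eq_bigr => t _; rewrite mulrCA.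
Qed.

Lemma wsumSr (R : comNzRingType) (T : Type) (A : seq T) (W : T -> R) m f :
  wsum A W m.+1 f = wsum A W m (fun w => \sum_(t <- A) W t * f (rcons w t)).
Proof.
elim: m f => [|m IH] f.
  by rewrite wsumS wsum0; apply: eq_bigr => t _; rewrite wsum0.
by rewrite wsumS [RHS]wsumS; apply: eq_bigr => t _; rewrite IH.
Qed.

(** Only the distribution of the images of the letters matters. *)
Lemma wsum_map (R : comNzRingType) (T T' : Type) (A : seq T) (B : seq T')
    (W : T -> R) (W' : T' -> R) (h : T -> T') m f :
  (forall g, \sum_(t <- A) W t * g (h t) = \sum_(c <- B) W' c * g c) ->
  wsum A W m (fun w => f (map h w)) = wsum B W' m f.
Proof.
move=> hAB; elim: m f => [|m IH] f; first by rewrite !wsum0.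
rewrite !wsumS -hAB; apply: eq_bigr => t _; congr (_ * _).
exact: (IH (fun w => f (h t :: w))).
Qed.

Lemma wsumD (R : comNzRingType) (T : Type) (A : seq T) (W : T -> R) m f g :
  wsum A W m (fun w => f w + g w) = wsum A W m f + wsum A W m g.
Proof. by rewrite /wsum -big_split; apply: eq_bigr => w _; rewrite mulrDr. Qed.

Lemma wsumZ (R : comNzRingType) (T : Type) (A : seq T) (W : T -> R) m x f :
  wsum A W m (fun w => x * f w) = x * wsum A W m f.
Proof. by rewrite /wsum mulr_sumr; apply: eq_bigr => w _; rewrite mulrCA. Qed.

Lemma le_wsum (R : realDomainType) (T : Type) (A : seq T) (W : T -> R) m f g :
  (forall t, 0 <= W t) -> (forall w, f w <= g w) -> wsum A W m f <= wsum A W m g.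
Proof.
move=> W0 fg; apply: ler_sum => w _; apply: ler_wpM2l => //.
by apply: prodr_ge0.
Qed.

Lemma wsum1 (R : comNzRingType) (T : Type) (A : seq T) (W : T -> R) m :
  \sum_(t <- A) W t = 1 -> wsum A W m (fun=> 1) = 1.
Proof.
move=> W1; elim: m => [|m IH]; first by rewrite wsum0.
by rewrite wsumS -[RHS]W1; apply: eq_bigr => t _; rewrite IH mulr1.
Qed.

Lemma wsum_cvg (R : realType) (T : Type) (A : seq T) (W : nat -> T -> R) (W' : T -> R)
    m (f : nat -> seq T -> R) (f' : seq T -> R) :
  (forall t, W k t @[k --> \oo] --> W' t) ->
  (forall w, f k w @[k --> \oo] --> f' w) ->
  wsum A (W k) m (f k) @[k --> \oo] --> wsum A W' m f'.
Proof.
move=> WW; elim: m f f' => [|m IH] f f' ff.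
  rewrite wsum0; have -> : (fun k => wsum A (W k) 0 (f k)) = f ^~ [::].
    by apply/funext => k; rewrite wsum0.
  exact: ff.
rewrite wsumS.
have -> : (fun k => wsum A (W k) m.+1 (f k)) =
    (fun k => \sum_(t <- A) W k t * wsum A (W k) m (fun w => f k (t :: w))).
  by apply/funext => k; rewrite wsumS.
apply: cvg_big => [|t _]; first exact: add_continuous.
by apply: cvgM; [exact: WW|apply: IH => w; exact: ff].
Qed.

(** * From trees to categories *)

Fixpoint tree_gf (R : comNzRingType) (k : nat) (x : R) : R :=
  if k is k'.+1 then x + tree_gf k' x ^+ 2 else x.

Lemma sum_trees (R : comNzRingType) k (x : R) :
  \sum_(t <- trees k) x ^+ leaves t = tree_gf k x.
Proof.
elim: k => [|k IH] /=; first by rewrite big_seq1 expr1.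
rewrite big_cons expr1 big_allpairs_dep; congr (_ + _).
rewrite expr2 -IH mulr_suml; apply: eq_bigr => A _; rewrite mulr_sumr.
by apply: eq_bigr => B _; rewrite exprD.
Qed.

Definition cats : seq category := [:: CE; CL; CH].

(** The masses of the leaf, of the trees that are neither the leaf nor of the
    top height, and of those of the top height, when the trees of less than the
    top height have mass [m] and all the trees have mass [q]. *)
Definition cat_mass (R : comNzRingType) (x m q : R) (c : category) : R :=
  match c with CE => x | CL => m - x | CH => q - m end.

Lemma sum_cats (R : comNzRingType) (F : category -> R) :
  \sum_(c <- cats) F c = F CE + F CL + F CH.
Proof. by rewrite !big_cons big_nil addr0 addrA. Qed.

Lemma sum_trees_cat (R : comNzRingType) k (x : R) (g : category -> R) :
  \sum_(t <- trees k.+1) x ^+ leaves t * g (cat_of k.+1 t) =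
  \sum_(c <- cats) cat_mass x (tree_gf k x) (tree_gf k.+1 x) c * g c.
Proof.
have catE t : t \in trees k.+1 -> x ^+ leaves t * g (cat_of k.+1 t) =
    x ^+ leaves t * g CH
    + (if (height t <= k)%N then x ^+ leaves t * (g CL - g CH) else 0)
    + (if t == Leaf then x ^+ leaves t * (g CE - g CL) else 0).
  rewrite mem_trees; case: t => [_|A B hAB].
    by rewrite eqxx /=; ring.
  have -> : (Node A B == Leaf) = false by apply/eqP.
  rewrite /cat_of; have [->|ne] := eqVneq (height (Node A B)) k.+1.
    by rewrite ltnn; ring.
  have -> : (height (Node A B) <= k)%N by rewrite -ltnS ltn_neqAle ne.
  by ring.
rewrite big_seq (eq_bigr _ catE) -big_seq !big_split/= -!big_mkcond/=.
rewrite -!mulr_suml sum_cats -/(trees k.+1).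
have -> : \sum_(t <- trees k.+1 | (height t <= k)%N) x ^+ leaves t = tree_gf k x.
  rewrite -sum_trees -big_filter; apply/perm_big/uniq_perm.
  - by rewrite filter_uniq ?trees_uniq.
  - exact: trees_uniq.
  move=> t; rewrite mem_filter !mem_trees; apply: andb_idr.
  exact: leqW.
have -> : \sum_(t <- trees k.+1 | t == Leaf) x ^+ leaves t = x.
  by rewrite -big_filter filter_pred1_uniq ?trees_uniq ?mem_trees// big_seq1 expr1.
by rewrite -/(trees k.+1) sum_trees [tree_gf k.+1 x]/= /cat_mass; ring.
Qed.

Definition node_cat (c d : category) : category :=
  match c, d with CH, _ | _, CH => CH | _, _ => CL end.

Definition child_cat (c : category) : category := if c is CE then CE else CL.

(** A child of a tree of height at most [k + 2] cannot have the top height, but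
    its own category with respect to [k + 1] tells whether it makes its parent
    have it. *)
Lemma cat_of_child k t : (height t <= k.+1)%N ->
  cat_of k.+2 t = child_cat (cat_of k.+1 t).
Proof.
case: t => // A B; rewrite /cat_of => h.
by rewrite (ltn_eqF (leq_ltn_trans h _))//; case: ifP.
Qed.

Lemma cat_of_node k A B : (height A <= k.+1)%N -> (height B <= k.+1)%N ->
  cat_of k.+2 (Node A B) = node_cat (cat_of k.+1 A) (cat_of k.+1 B).
Proof.
move=> hA hB.
have catH t : (height t == k.+1) = (if cat_of k.+1 t is CH then true else false).
  by case: t => // ? ?; rewrite /cat_of; case: eqP.
have -> : cat_of k.+2 (Node A B) =
    if (height A == k.+1) || (height B == k.+1) then CH else CL.
  rewrite /cat_of /= eqSS; congr (if _ then _ else _).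
  by apply/idP/idP; lia.
by rewrite !catH; case: (cat_of _ A); case: (cat_of _ B).
Qed.

Definition retained_mass (R : comNzRingType) (p : category -> R) (a : nat)
    (U : set (word a 1)) : R :=
  wsum cats p a.+2 (fun o => (allowed U o)%:R).

Definition horizontal_mass (R : comNzRingType) (p : category -> R) (a : nat)
    (U : set (word a 1)) : R :=
  wsum cats p a.+3 (fun o => (allowed U (take a.+2 o) && allowed U (behead o))%:R).

(** [p] and [p'] are the category masses of the trees of height at most [k] and
    at most [k - 1]; the marked tree has children in the latter class. *)
Definition vertical_mass (R : comNzRingType) (p p' : category -> R) (a : nat)
    (U : set (word a 1)) : R :=
  wsum cats p a (fun x =>
    \sum_(c <- cats) p' c * \sum_(d <- cats) p' d * \sum_(y <- cats) p y *
      (allowed U (rcons (rcons x (node_cat c d)) y) &&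
       allowed U (rcons (rcons x (child_cat c)) (child_cat d)))%:R).

Lemma window_massE (R : realType) k (x : R) m Q :
  window_mass k x m Q = wsum (trees k) (fun t => x ^+ leaves t) m (fun w => (Q w)%:R).
Proof.
rewrite /window_mass /wsum big_mkcond; apply: eq_bigr => w _.
have -> : \prod_(t <- w) x ^+ leaves t = x ^+ forest_leaves w.
  by rewrite /forest_leaves; elim/big_rec2: _ => // t n y _ ->; rewrite exprD.
by case: (Q w); rewrite ?mulr1 ?mulr0.
Qed.

Section Masses.
Variables (R : realType) (k : nat) (x : R) (a : nat) (U : set (word a 1)).
Let p := cat_mass x (tree_gf k.+1 x) (tree_gf k.+2 x).
Let p' := cat_mass x (tree_gf k x) (tree_gf k.+1 x).

Lemma retained_massE :
  window_mass k.+2 x (a + 1).+1 (fun w => allowed U (map (cat_of k.+2) w)) =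
  retained_mass p U.
Proof.
rewrite window_massE addn1; apply: wsum_map => g; exact: sum_trees_cat.
Qed.

Lemma horizontal_massE :
  window_mass k.+2 x (a + 2).+1 (horizontal_window U k.+2) = horizontal_mass p U.
Proof.
rewrite window_massE addn2 /horizontal_window addn1.
rewrite -[RHS](@wsum_map _ _ _ (trees k.+2) _ (fun t => x ^+ leaves t) _ (cat_of k.+2)).
  by apply: eq_wsum => w _; rewrite map_take behead_map.
by move=> g; exact: sum_trees_cat.
Qed.

Lemma vertical_massE :
  window_mass k.+2 x (a + 1).+1 (vertical_window U k.+2) = vertical_mass p p' U.
Proof.
rewrite window_massE addn1 2!wsumSr.
rewrite -[RHS](@wsum_map _ _ _ (trees k.+2) _ (fun t => x ^+ leaves t) _ (cat_of k.+2));
  last by move=> g; exact: sum_trees_cat.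
apply: eq_wsum => w sw.
have vE t y : vertical_window U k.+2 (rcons (rcons w t) y) =
    if t is Node A B then
      allowed U (rcons (rcons (map (cat_of k.+2) w) (cat_of k.+2 t)) (cat_of k.+2 y)) &&
      allowed U (rcons (rcons (map (cat_of k.+2) w) (cat_of k.+2 A)) (cat_of k.+2 B))
    else false.
  have nthE : nth Leaf (rcons (rcons w t) y) a = t.
    by rewrite !nth_rcons size_rcons sw ltnSn ltnn eqxx.
  have takeE : take a (rcons (rcons w t) y) = w.
    by rewrite -sw -!cats1 -catA take_size_cat.
  rewrite /vertical_window nthE takeE !map_rcons.
  by case: t {nthE takeE} => [|A B]; rewrite ?andbF// -!cats1 -!catA map_cat.
have tE : trees k.+2 =
  Leaf :: [seq Node A B | A <- trees k.+1, B <- trees k.+1] by [].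
rewrite {1}tE big_cons big1 ?mulr0 ?add0r; last by move=> y _; rewrite vE mulr0.
rewrite big_allpairs_dep -sum_trees_cat big_seq [RHS]big_seq.
apply: eq_bigr => A; rewrite mem_trees => hA.
rewrite -sum_trees_cat mulr_sumr big_seq [RHS]big_seq.
apply: eq_bigr => B; rewrite mem_trees => hB.
rewrite [leaves _]/= exprD -mulrA; congr (_ * (_ * _)).
rewrite -sum_trees_cat; apply: eq_bigr => y _.
by rewrite vE cat_of_node// (cat_of_child hA) (cat_of_child hB).
Qed.

End Masses.

(** * Vertical edges in a fixed context *)

Lemma limit_weights_bounds (R : realFieldType) (q m : R) :
  0 < q -> 0 < m -> q ^+ 2 = 3 / 4 -> m ^+ 2 = q - 1 / 4 ->
  [/\ 6 / 7 < q, q < 13 / 15, 7 / 9 < m & m < 4 / 5].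
Proof.
move=> q0 m0 q2 m2.
have q1 : 6 / 7 < q by nra.
have q3 : q < 13 / 15 by nra.
by split => //; nra.
Qed.

(** The letters E, L and H have masses [1 / 4], [q - 1 / 4] and [1 - q], and [rE],
    [rL], [rH] are the probabilities that they and a random letter are retained
    at the marked position; [u], [v], [w], [z] say whether EE, EL, LE, LL are.
    The marked trees whose two children are retained have mass [al] in category
    L and [be] in category H, so that the left side weighs the vertical edges.
    Without the truncations at [3 / 4] the bound would hold because [al] and [be]
    are at most the masses of L and H.  What the truncations take away is made up
    for by the term of E as far as EE and EL are retained; when they are not,
    pairs of children are missing, which keeps [al] and [be] away from the masses
    of L and H. *)
Lemma vertical_truncation (R : realFieldType) (q m : R) (u v w z : bool) (rE rL rH : R) :
  0 < q -> 0 < m -> q ^+ 2 = 3 / 4 -> m ^+ 2 = q - 1 / 4 ->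
  0 <= rH <= 1 -> rL <= 1 ->
  1 / 4 * u%:R + (q - 1 / 4) * v%:R <= rE ->
  1 / 4 * w%:R + (q - 1 / 4) * z%:R <= rL ->
  let l := m - 1 / 4 in let h := q - m in
  let al := 1 / 16 * u%:R + 1 / 4 * l * (v%:R + w%:R) + l ^+ 2 * z%:R in
  let be := 1 / 4 * h * (v%:R + w%:R) + ((l + h) ^+ 2 - l ^+ 2) * z%:R in
  al * rL + be * rH <=
  1 / 4 * Num.min rE (3 / 4) + (q - 1 / 4) * Num.min rL (3 / 4)
   + (1 - q) * Num.min rH (3 / 4).
Proof.
move=> q0 m0 q2 m2 /andP[rH0 rH1] rL1 hE hL /=.
(* The two squares are affine in [q] and [m], so that all bounds below on [al]
   and [be] follow from the rational enclosures. *)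
have [q_lo q_hi m_lo m_hi] := limit_weights_bounds q0 m0 q2 m2.
have -> : (m - 1 / 4 + (q - m)) ^+ 2 - (m - 1 / 4) ^+ 2
          = 1 - q * (3 / 2) + m / 2.
  by clear - q2 m2; lra.
have -> : (m - 1 / 4) ^+ 2 = q - m / 2 - 3 / 16.
  by clear - q2 m2; lra.
clear q0 m0 q2 m2.
set al := (X in X * rL); set be := (X in X * rH).
have [al0 alL] : 0 <= al /\ al <= q - 1 / 4.
  rewrite /al; clear - q_lo q_hi m_lo m_hi.
  by split; case: u v w z => -[] [] [] /=; lra.
have [be0 beH] : 0 <= be /\ be <= 1 - q.
  rewrite /be; clear - q_lo q_hi m_lo m_hi.
  by split; case: v w z => -[] [] /=; lra.
have alv : ~~ v -> al <= q - 1 / 4 - 1 / 8.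
  rewrite /al; clear - q_lo q_hi m_lo m_hi.
  by case: u v w z => -[] [] [] /=; lra.
have bevz : ~~ v -> ~~ z -> be <= 1 / 20.
  rewrite /be; clear - q_lo q_hi m_lo m_hi.
  by case: v w z => -[] [] /=; lra.
have aluv : al <= 1 / 16 * u%:R + 1 / 4 * (m - 1 / 4) * v%:R + (q - m / 4 - 1 / 4).
  rewrite /al; clear - q_lo q_hi m_lo m_hi.
  by case: w z => -[] /=; lra.
have abuv : al + be <= 1 / 16 * u%:R + 1 / 4 * (q - 1 / 4) * v%:R + (3 / 4 - q / 4).
  rewrite /al /be; clear - q_lo q_hi m_lo m_hi.
  by case: w z => -[] /=; lra.
have alE : al - 3 / 4 * (q - 1 / 4) <= 1 / 4 * Num.min rE (3 / 4).
  apply: le_trans (lerB aluv (lexx _)) _; clear - q_lo q_hi m_lo m_hi hE.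
  case: (leP rE (3 / 4)) => _;
  by case: u v hE => -[] /=; lra.
have abE : al + be - 9 / 16 <= 1 / 4 * Num.min rE (3 / 4).
  apply: le_trans (lerB abuv (lexx _)) _; clear - q_lo q_hi m_lo m_hi hE.
  case: (leP rE (3 / 4)) => _;
  by case: u v hE => -[] /=; lra.
have vE : v -> 1 - q <= Num.min rE (3 / 4).
  clear - q_lo q_hi m_lo m_hi hE.
  by rewrite le_min; case: u v hE => -[] //=; lra.
have zL : z -> q - 1 / 4 <= rL.
  clear - q_lo q_hi m_lo m_hi hL.
  by case: w z hL => -[] //=; lra.
have mE : 0 <= Num.min rE (3 / 4).
  clear - q_lo q_hi m_lo m_hi hE.
  by rewrite le_min; case: u v hE => -[] //=; lra.
have rL0 : 0 <= rL.
  clear - q_lo q_hi m_lo m_hi hL.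
  by case: w z hL => -[] //=; lra.
have a1 : 0 <= al * (1 - rL) by rewrite mulr_ge0// subr_ge0.
have b1 : 0 <= be * (1 - rH) by rewrite mulr_ge0// subr_ge0.
have a2 : 0 <= (q - 1/4 - al) * rL by rewrite mulr_ge0// subr_ge0.
have b2 : 0 <= (1 - q - be) * rH by rewrite mulr_ge0// subr_ge0.
clearbody al be; clear hE hL.
have [[mL sL]|[mL sL]] : Num.min rL (3 / 4) = rL /\ rL <= 3 / 4 \/
    Num.min rL (3 / 4) = 3 / 4 /\ 3 / 4 < rL by case: leP; [left|right].
  all: have [[mH sH]|[mH sH]] : Num.min rH (3 / 4) = rH /\ rH <= 3 / 4 \/
    Num.min rH (3 / 4) = 3 / 4 /\ 3 / 4 < rH by case: leP; [left|right].
  all: rewrite mL mH {mL mH}.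
- by lra.
- (* Here [rH] is truncated and [rL] is not.  If EL is not retained, [rE] may
     vanish, and the compensation comes from the missing pairs of children. *)
  have [/vE v1|v0] := boolP v; first by lra.
  have [/zL z1|z0] := boolP z; last by have := bevz v0 z0; lra.
  have a3 : 0 <= (q - 1 / 4 - 1 / 8 - al) * rL.
    by rewrite mulr_ge0// subr_ge0 alv.
  by lra.
- by lra.
- by lra.
Qed.

(** Moving the positive parts to the right turns [r c] into the minimum of [r c]
    and [3 / 4]: this is [vertical_truncation] for the pairs allowed by [b]. *)
Lemma local_bound (R : realFieldType) (q m : R) (b : category -> category -> bool)
    (p := cat_mass (1 / 4) q 1) (p' := cat_mass (1 / 4) m q)
    (r := fun c => \sum_(y <- cats) p y * (b c y)%:R) :
  0 < q -> 0 < m -> q ^+ 2 = 3 / 4 -> m ^+ 2 = q - 1 / 4 ->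
  \sum_(c <- cats) p' c * \sum_(d <- cats) p' d * \sum_(y <- cats) p y *
    (b (node_cat c d) y && b (child_cat c) (child_cat d))%:R
  + \sum_(c <- cats) p c * Num.max 0 (r c - 3 / 4) <= \sum_(c <- cats) p c * r c.
Proof.
move=> q0 m0 q2 m2.
have [q_lo q_hi m_lo m_hi] := limit_weights_bounds q0 m0 q2 m2.
have bE c d n : \sum_(y <- cats) p y * (b n y && b c d)%:R = (b c d)%:R * r n.
  rewrite /r mulr_sumr; apply: eq_bigr => y _.
  by rewrite -mulnb natrM; ring.
under eq_bigr => c _ do under eq_bigr => d _ do rewrite bE.
rewrite !sum_cats /=.
have p_ge0 c : 0 <= p c.
  by rewrite /p; clear - q_lo q_hi; case: c => /=; lra.
have r_ge0 c : 0 <= r c by rewrite sumr_ge0// => y _; rewrite mulr_ge0.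
have r_le1 c : r c <= 1.
  have -> : 1 = \sum_(y <- cats) p y by rewrite sum_cats /p /=; ring.
  by apply: ler_sum => y _; rewrite ler_piMr// lern1 leq_b1.
have r_ge c : 1 / 4 * (b c CE)%:R + (q - 1 / 4) * (b c CL)%:R <= r c.
  by rewrite /r sum_cats /p /= lerDl mulr_ge0//; clear - q_hi; lra.
have maxE (y : R) : Num.max 0 (y - 3 / 4) = y - Num.min y (3 / 4).
  by clear; case: (leP y (3 / 4)) => ?; case: (leP 0 (y - 3 / 4)) => ?; lra.
have rH01 : 0 <= r CH <= 1 by rewrite r_ge0 r_le1.
have := vertical_truncation q0 m0 q2 m2 rH01 (r_le1 CL) (r_ge CE) (r_ge CL).
rewrite !maxE /=.
move: (Num.min (r CE) _) (Num.min (r CL) _) (Num.min (r CH) _) => nE nL nH.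
move: (r CE) (r CL) (r CH) => rE rL rH.
move: (b CE CE)%:R (b CE CL)%:R (b CL CE)%:R (b CL CL)%:R => u v w z.
rewrite -subr_ge0 => H; rewrite -subr_ge0; apply: le_trans H _.
rewrite le_eqVlt; apply/orP; left; apply/eqP; by field.
Qed.

(** * The bound on the number of edges *)

Lemma allowed_max (a : nat) (o : seq category) :
  size o = a.+2 -> allowed [set: word a 1] o.
Proof.
move=> so; apply/asboolP.
have so' : size o == (a + 1).+1 by rewrite so addn1.
by exists (Tuple so').
Qed.

(** Conditioned on the letters shared by two consecutive windows, the events
    that either window is retained are independent. *)
Lemma horizontal_mass_overlap (R : comNzRingType) (p : category -> R) a
    (U : set (word a 1)) :
  horizontal_mass p U = wsum cats p a.+1 (fun w =>
    (\sum_(c <- cats) p c * (allowed U (c :: w))%:R) *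
    (\sum_(d <- cats) p d * (allowed U (rcons w d))%:R)).
Proof.
rewrite /horizontal_mass wsumSl wsumSr; apply: eq_wsum => w sw.
rewrite mulr_sumr; apply: eq_bigr => d _; rewrite [RHS]mulrCA; congr (_ * _).
rewrite mulr_suml; apply: eq_bigr => c _; rewrite -mulrA -natrM mulnb.
by rewrite [take _ _]/= -cats1 take_size_cat.
Qed.

(** With [out w] and [r w] the two sums in [horizontal_mass_overlap],
    [out w * r w <= 3 / 4 * out w + max 0 (r w - 3 / 4)]; the first term sums to
    [3 / 4] of the retained mass, and the second one is absorbed together with
    the vertical edges by the retained mass itself. *)
Lemma edge_mass_bound (R : realFieldType) (q m : R) a (U : set (word a 1))
    (p := cat_mass (1 / 4) q 1) (p' := cat_mass (1 / 4) m q) :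
  0 < q -> 0 < m -> q ^+ 2 = 3 / 4 -> m ^+ 2 = q - 1 / 4 ->
  horizontal_mass p U + vertical_mass p p' U <= 7 / 4 * retained_mass p U.
Proof.
move=> q0 m0 q2 m2.
have [q_lo q_hi m_lo m_hi] := limit_weights_bounds q0 m0 q2 m2.
have p_ge0 c : 0 <= p c by rewrite /p; clear - q_lo q_hi; case: c => /=; lra.
have p1 : \sum_(c <- cats) p c = 1 by rewrite sum_cats /p /=; ring.
pose out w := \sum_(c <- cats) p c * (allowed U (c :: w))%:R.
pose r w := \sum_(d <- cats) p d * (allowed U (rcons w d))%:R.
have out01 w : 0 <= out w <= 1.
  rewrite sumr_ge0/= => [|c _]; last by rewrite mulr_ge0.
  rewrite -p1; apply: ler_sum => c _.
  by rewrite ler_piMr// lern1 leq_b1.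
have H : horizontal_mass p U <= 3 / 4 * retained_mass p U +
    wsum cats p a (fun x => \sum_(c <- cats) p c * Num.max 0 (r (rcons x c) - 3 / 4)).
  rewrite horizontal_mass_overlap.
  have -> : retained_mass p U = wsum cats p a.+1 out.
    by rewrite /retained_mass wsumSl.
  have -> : wsum cats p a (fun x =>
      \sum_(c <- cats) p c * Num.max 0 (r (rcons x c) - 3 / 4)) =
    wsum cats p a.+1 (fun w => Num.max 0 (r w - 3 / 4)) by rewrite wsumSr.
  rewrite -wsumZ -wsumD; apply: le_wsum => // w; rewrite -/(out w) -/(r w).
  have /andP[out_ge0 out_le1] := out01 w.
  rewrite -lerBlDl mulrC -mulrBl mulrC.
  have [rs|rs] := leP (r w - 3 / 4) 0; first exact: mulr_ge0_le0.
  by rewrite ler_piMl// ltW.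
have V : vertical_mass p p' U + wsum cats p a (fun x =>
    \sum_(c <- cats) p c * Num.max 0 (r (rcons x c) - 3 / 4)) <= retained_mass p U.
  rewrite /vertical_mass /retained_mass 2!wsumSr -wsumD; apply: le_wsum => // x.
  exact: (local_bound (fun c d => allowed U (rcons (rcons x c) d))).
lra.
Qed.

Lemma retained_mass_full (R : comNzRingType) (p : category -> R) a :
  \sum_(c <- cats) p c = 1 -> retained_mass p [set: word a 1] = 1.
Proof.
move=> p1; rewrite -[RHS](wsum1 a.+2 p1); apply: eq_wsum => w sw.
by rewrite allowed_max.
Qed.

Lemma horizontal_mass_full (R : comNzRingType) (p : category -> R) a :
  \sum_(c <- cats) p c = 1 -> horizontal_mass p [set: word a 1] = 1.
Proof.
move=> p1; rewrite -[RHS](wsum1 a.+3 p1); apply: eq_wsum => w sw.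
by rewrite !allowed_max// ?size_behead ?size_takel ?sw.
Qed.

Lemma vertical_mass_full (R : comNzRingType) (p p' : category -> R) a :
  \sum_(c <- cats) p c = 1 ->
  vertical_mass p p' [set: word a 1] = (\sum_(c <- cats) p' c) ^+ 2.
Proof.
move=> p1; rewrite -[RHS]mulr1 -(wsum1 a p1) -wsumZ; apply: eq_wsum => x sx.
rewrite mulr1 expr2 mulr_suml; apply: eq_bigr => c _; rewrite !mulr_sumr.
apply: eq_bigr => d _; rewrite (_ : \sum_(y <- cats) _ = 1) ?mulr1//.
transitivity (\sum_(y <- cats) p y) => //; apply: eq_bigr => y _.
by rewrite !allowed_max ?size_rcons ?sx//= mulr1.
Qed.

Lemma wsum_gt0 (R : realDomainType) (p : category -> R) (f : seq category -> R) o :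
  (forall c, 0 < p c) -> (forall w, 0 <= f w) -> 0 < f o ->
  0 < wsum cats p (size o) f.
Proof.
move=> p0 f0; have ge0 m g : (forall w, 0 <= g w) -> 0 <= wsum cats p m g.
  move=> g0; rewrite sumr_ge0// => w _; rewrite mulr_ge0// prodr_ge0// => c _.
  exact: ltW.
elim: o f f0 => [|c o IH] f f0 fo; first by rewrite wsum0.
have fc : 0 < wsum cats p (size o) (fun w => f (c :: w)) by exact: IH.
change (size (c :: o)) with (size o).+1; rewrite wsumS sum_cats.
have t0 d : 0 <= p d * wsum cats p (size o) (fun w => f (d :: w)).
  by rewrite mulr_ge0 ?ge0// ltW.
have tc : 0 < p c * wsum cats p (size o) (fun w => f (c :: w)) by rewrite mulr_gt0.
by move: (t0 CE) (t0 CL) (t0 CH); case: c {fo fc} tc => tc; lra.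
Qed.

Lemma retained_mass_gt0 (R : realDomainType) (p : category -> R) a (U : set (word a 1)) :
  (forall c, 0 < p c) -> U !=set0 -> 0 < retained_mass p U.
Proof.
move=> p0 [w Uw]; have sw : size (tval w) = a.+2 by rewrite size_tuple addn1.
rewrite /retained_mass -sw; apply: wsum_gt0 => //.
have -> : allowed U (tval w) by apply/asboolP; exists w.
exact: ltr01.
Qed.

(** * The limit as the height grows *)

Lemma tree_gf_continuous (R : realType) k : continuous (@tree_gf R k).
Proof.
elim: k => [|k IH] x /=; first exact: cvg_id.
by apply: cvgD; [exact: cvg_id|apply: cvgM; exact: IH].
Qed.

Lemma tree_gf_ge0 (R : realDomainType) k (x : R) : 0 <= x -> 0 <= tree_gf k x.
Proof. by move=> x0; case: k => //= k; rewrite addr_ge0// sqr_ge0. Qed.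

(** At [1 / 4] the iteration [y |-> x + y ^+ 2] has the fixed point [1 / 2], which
    it cannot cross from below. *)
Lemma tree_gf_le_half (R : realFieldType) k (x : R) :
  0 <= x -> x <= 1 / 4 -> tree_gf k x <= 1 / 2.
Proof.
move=> x0 x4; elim: k => [|k IH] /=; first by lra.
by have := tree_gf_ge0 k x0; nra.
Qed.

(** Above [1 / 4] the iteration [y |-> x + y ^+ 2] increases by at least
    [x - 1 / 4] at each step. *)
Lemma tree_gf_ge (R : realFieldType) k (x : R) : 1 / 4 <= x ->
  k%:R * (x - 1 / 4) <= tree_gf k x.
Proof.
move=> x4; elim: k => [|k IH] /=; first by lra.
have := sqr_ge0 (tree_gf k x - 1 / 2); rewrite -[k.+1%:R]natr1; lra.
Qed.

Lemma critical_weight_exists (R : realType) k :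
  exists x : R, [/\ 1 / 4 < x, x <= 1 & tree_gf k x = 1].
Proof.
have gf0 : tree_gf k (0 : R) = 0.
  by elim: k => //= k ->; rewrite expr0n addr0.
have gf1 : 1 <= tree_gf k (1 : R).
  by case: k {gf0} => //= k; rewrite lerDl sqr_ge0.
have [|||x] := @IVT R (tree_gf k) 0 1 1.
- by [].
- exact/continuous_subspaceT/tree_gf_continuous.
- by rewrite gf0 min_l ?max_r ?gf1 ?ler01// (le_trans _ gf1).
rewrite in_itv/= => /andP[x0 x1] gfx; exists x; split => //.
rewrite ltNge; apply/negP => x4.
by have := tree_gf_le_half k x0 x4; rewrite gfx; lra.
Qed.

(** The weight of a leaf at which the trees of height at most [k] have total mass
    one; its inverse is the exponential growth rate of the number of forests. *)
Definition critical_weight (R : realType) (k : nat) : R :=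
  projT1 (cid (critical_weight_exists R k)).

Lemma critical_weightP (R : realType) k :
  [/\ 1 / 4 < critical_weight R k, critical_weight R k <= 1
    & tree_gf k (critical_weight R k) = 1].
Proof. exact: projT2 (cid (critical_weight_exists R k)). Qed.

Lemma critical_weight_cvg (R : realType) :
  critical_weight R k.+2 @[k --> \oo] --> (1 / 4 : R).
Proof.
have h0 : 1 / 4 + k.+1%:R^-1 @[k --> \oo] --> (1 / 4 + 0 : R).
  by apply: cvgD; [exact: cvg_cst|exact: cvg_harmonic].
rewrite addr0 in h0.
apply: (squeeze_cvgr _ (cvg_cst (1 / 4 : R)) h0); near=> k.
have [l4 l1 gf] := critical_weightP R k.+2.
rewrite ltW//= -lerBlDl -[leRHS]mul1r ler_pdivlMr// mulrC.
apply: (@le_trans _ _ (k.+2%:R * (critical_weight R k.+2 - 1 / 4))).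
  by rewrite ler_wpM2r ?ler_nat// subr_ge0 ltW.
by have := tree_gf_ge k.+2 (ltW l4); rewrite gf.
Unshelve. all: by end_near.
Qed.

(** With respect to the height [k + 2]: the mass of the trees below the top
    height, and that of the trees that are lower still, which are the children
    of the former. *)
Definition below_top_mass (R : realType) k : R := tree_gf k.+1 (critical_weight R k.+2).
Definition below_second_mass (R : realType) k : R := tree_gf k (critical_weight R k.+2).

Lemma below_top_massE (R : realType) k :
  below_top_mass R k = Num.sqrt (1 - critical_weight R k.+2).
Proof.
have [l4 l1 gf] := critical_weightP R k.+2.
have -> : 1 - critical_weight R k.+2 = below_top_mass R k ^+ 2.
  by rewrite -[1]gf /= addrAC subrr add0r.
by rewrite sqrtr_sqr ger0_norm// tree_gf_ge0//; lra.
Qed.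

Lemma below_second_massE (R : realType) k :
  below_second_mass R k = Num.sqrt (below_top_mass R k - critical_weight R k.+2).
Proof.
have [l4 l1 gf] := critical_weightP R k.+2.
have -> : below_top_mass R k - critical_weight R k.+2 = below_second_mass R k ^+ 2.
  by rewrite /below_top_mass /= addrAC subrr add0r.
by rewrite sqrtr_sqr ger0_norm// tree_gf_ge0//; lra.
Qed.

Definition limit_below_top (R : realType) : R := Num.sqrt (1 - 1 / 4).
Definition limit_below_second (R : realType) : R :=
  Num.sqrt (limit_below_top R - 1 / 4).

Lemma limit_below_topP (R : realType) :
  0 < limit_below_top R /\ limit_below_top R ^+ 2 = 3 / 4.
Proof.
by split; [rewrite sqrtr_gt0; lra|rewrite sqr_sqrtr; lra].
Qed.

Lemma limit_below_secondP (R : realType) :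
  0 < limit_below_second R /\ limit_below_second R ^+ 2 = limit_below_top R - 1 / 4.
Proof.
have [q0 q2] := limit_below_topP R; have q4 : 1 / 4 < limit_below_top R by nra.
by split; [rewrite sqrtr_gt0; lra|rewrite sqr_sqrtr//; lra].
Qed.

Lemma below_top_mass_cvg (R : realType) :
  below_top_mass R k @[k --> \oo] --> limit_below_top R.
Proof.
have -> : below_top_mass R = (fun k => Num.sqrt (1 - critical_weight R k.+2)).
  by apply/funext => k; exact: below_top_massE.
apply: continuous_cvg; first exact: sqrt_continuous.
by apply: cvgB; [exact: cvg_cst|exact: critical_weight_cvg].
Qed.

Lemma below_second_mass_cvg (R : realType) :
  below_second_mass R k @[k --> \oo] --> limit_below_second R.
Proof.
have -> : below_second_mass R =
    (fun k => Num.sqrt (below_top_mass R k - critical_weight R k.+2)).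
  by apply/funext => k; exact: below_second_massE.
apply: continuous_cvg; first exact: sqrt_continuous.
by apply: cvgB; [exact: below_top_mass_cvg|exact: critical_weight_cvg].
Qed.

Lemma cat_mass_cvg (R : realType) (x m q : nat -> R) (x' m' q' : R) c :
  x k @[k --> \oo] --> x' -> m k @[k --> \oo] --> m' -> q k @[k --> \oo] --> q' ->
  cat_mass (x k) (m k) (q k) c @[k --> \oo] --> cat_mass x' m' q' c.
Proof. by move=> ? ? ?; case: c => //=; apply: cvgB. Qed.

Definition tree_mass (R : realType) k : category -> R :=
  cat_mass (critical_weight R k.+2) (below_top_mass R k) 1.
Definition child_mass (R : realType) k : category -> R :=
  cat_mass (critical_weight R k.+2) (below_second_mass R k) (below_top_mass R k).
Definition limit_tree_mass (R : realType) : category -> R :=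
  cat_mass (1 / 4) (limit_below_top R) 1.
Definition limit_child_mass (R : realType) : category -> R :=
  cat_mass (1 / 4) (limit_below_second R) (limit_below_top R).

Lemma tree_mass_gt0 (R : realType) k c : 0 < tree_mass R k c.
Proof.
have [l4 l1 gf] := critical_weightP R k.+2.
have l0 : 0 < critical_weight R k.+2 by lra.
have m0 : 0 < below_second_mass R k.
  rewrite /below_second_mass; case: (k) (critical_weight R k.+2) l0 => //= j x x0.
  by rewrite ltr_wpDr// sqr_ge0.
have qE : below_top_mass R k = critical_weight R k.+2 + below_second_mass R k ^+ 2 by [].
have eq1 : 1 = critical_weight R k.+2 + below_top_mass R k ^+ 2 by rewrite -gf.
have q0 : 0 <= below_top_mass R k by rewrite tree_gf_ge0// ltW.
by case: c; rewrite /tree_mass /= ?qE; nra.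
Qed.

Lemma limit_tree_mass_gt0 (R : realType) c : 0 < limit_tree_mass R c.
Proof.
have [q0 q2] := limit_below_topP R.
by case: c; rewrite /limit_tree_mass /=; nra.
Qed.

Definition density_of_masses (R : realType) (p p' : category -> R) a
    (U : set (word a 1)) : R :=
  2 * (horizontal_mass p U + vertical_mass p p' U) / retained_mass p U.

Lemma dens_cvg (R : realType) a (c : boundary_convention a 1) (U : set (word a 1)) k :
  U !=set0 ->
  dens R (retained c U n k.+2) @[n --> \oo] -->
    density_of_masses (tree_mass R k) (child_mass R k) U.
Proof.
move=> U0; have [l4 l1 gf] := critical_weightP R k.+2.
have l0 : 0 < critical_weight R k.+2 by lra.
have m1 : \sum_(t <- trees k.+2) critical_weight R k.+2 ^+ leaves t = 1.
  by rewrite sum_trees.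
have := @dens_limit R k.+2 (critical_weight R k.+2) l0 m1 a c U.
rewrite retained_massE horizontal_massE vertical_massE gf.
apply; apply: retained_mass_gt0 => // d; exact: tree_mass_gt0.
Qed.

Lemma density_of_masses_cvg (R : realType) a (U : set (word a 1)) : U !=set0 ->
  density_of_masses (tree_mass R k) (child_mass R k) U @[k --> \oo] -->
    density_of_masses (limit_tree_mass R) (limit_child_mass R) U.
Proof.
move=> U0.
have hp d : tree_mass R k d @[k --> \oo] --> limit_tree_mass R d.
  by apply: cat_mass_cvg;
    [exact: critical_weight_cvg|exact: below_top_mass_cvg|exact: cvg_cst].
have hp' d : child_mass R k d @[k --> \oo] --> limit_child_mass R d.
  by apply: cat_mass_cvg;
    [exact: critical_weight_cvg|exact: below_second_mass_cvg|exact: below_top_mass_cvg].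
apply: cvgM; last first.
  apply: cvgV; last by apply: wsum_cvg => // w; exact: cvg_cst.
  rewrite gt_eqF//; apply: retained_mass_gt0 => // d.
  exact: limit_tree_mass_gt0.
apply: cvgM; first exact: cvg_cst.
apply: cvgD; first by apply: wsum_cvg => // w; exact: cvg_cst.
apply: wsum_cvg => // w.
apply: cvg_big => [|d _]; first exact: add_continuous.
apply: cvgM => //; apply: cvg_big => [|d' _]; first exact: add_continuous.
apply: cvgM => //; apply: cvg_big => [|y _]; first exact: add_continuous.
by apply: cvgM => //; exact: cvg_cst.
Qed.

Lemma inner_density_cvg (R : realType) a (c : boundary_convention a 1)
    (U : set (word a 1)) : U !=set0 ->
  inner_density R c U k @[k --> \oo] -->
    density_of_masses (limit_tree_mass R) (limit_child_mass R) U.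
Proof.
move=> U0; rewrite -(cvg_shiftn 2).
have -> : (fun k => inner_density R c U (k + 2)) =
    (fun k => density_of_masses (tree_mass R k) (child_mass R k) U).
  by apply/funext => k; rewrite addn2; apply/cvg_lim => //; exact: dens_cvg.
exact: density_of_masses_cvg.
Qed.

Lemma limiting_densityE (R : realType) a (c : boundary_convention a 1)
    (U : set (word a 1)) : U !=set0 ->
  limiting_density R c U =
    density_of_masses (limit_tree_mass R) (limit_child_mass R) U.
Proof. by move=> U0; apply/cvg_lim => //; exact: inner_density_cvg. Qed.

Theorem theorem6p2 (R : realType) (a : nat) (c : boundary_convention a 1) :
  [/\ forall U : set (word a 1), U !=set0 -> limiting_density_exists R c U,
      exists2 U : set (word a 1), U !=set0 & limiting_density R c U = 7 / 2 &
      forall U : set (word a 1), U !=set0 -> limiting_density R c U <= 7 / 2].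
Proof.
have [q0 q2] := limit_below_topP R; have [m0 m2] := limit_below_secondP R.
split.
- move=> U U0; split; last by apply/cvg_ex; eexists; exact: inner_density_cvg.
  move=> [|[|k]]// _; apply/cvg_ex; eexists; exact: dens_cvg.
- exists setT; first by exists [tuple CE | i < (a + 1).+1].
  rewrite limiting_densityE; last by exists [tuple CE | i < (a + 1).+1].
  have p1 : \sum_(d <- cats) limit_tree_mass R d = 1.
    by rewrite sum_cats /limit_tree_mass /=; ring.
  rewrite /density_of_masses retained_mass_full// horizontal_mass_full//.
  rewrite vertical_mass_full// sum_cats /limit_child_mass /=.
  have -> : 1 / 4 + (limit_below_second R - 1 / 4) +
      (limit_below_top R - limit_below_second R)
    = limit_below_top R by ring.
  by rewrite q2; field.
- move=> U U0; rewrite limiting_densityE// /density_of_masses.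
  have pi0 : 0 < retained_mass (limit_tree_mass R) U.
    by apply: retained_mass_gt0 => // d; exact: limit_tree_mass_gt0.
  rewrite ler_pdivrMr//.
  have := edge_mass_bound U q0 m0 q2 m2.
  by rewrite -/(limit_tree_mass R) -/(limit_child_mass R); lra.
Qed.
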